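(* Let $F(x)=x^4+ax^3+bx+c\in\mathbb{Z}[x]$ be irreducible over $\mathbb{Q}$, $\alpha$ a root of $F$ and $K=\mathbb{Q}(\alpha)$. Let $\mu=\nu_3(1-a-b+c)$, $\nu=\nu_3(-4+3a+b)$, $\omega=\nu_3(1+a+b+c)$ and $\tau=\nu_3(4+3a+b)$. Suppose one of the following holds: (1) $a\equiv\pm1\pmod3$, $b\equiv c\equiv0\pmod3$, $3\nu_3(b)<2\nu_3(c)$, $\nu_3(b)$ is even and $b_3\equiv-a\pmod3$; (2) $(a,b)\in\{(0,4),(3,22),(6,13),(9,4),(12,22),(15,13),(18,4),(21,22),(24,13)\}\pmod{27}$, $a+b\equiv1+c\pmod{243}$, and either (i) $2\nu<\mu+1$, or (ii) $2\nu>\mu+1$, $\mu$ is odd and $(1-a-b+c)_3\equiv1\pmod3$; (3) $(a,b)\in\{(0,23),(3,14),(6,5),(9,23),(12,14),(15,5),(18,23),(21,14),(24,5)\}\pmod{243}$, $a+b\equiv-(1+c)\pmod{243}$, and either (i) $2\tau<\omega+1$, or (ii) $2\tau>\omega+1$, $\omega$ is odd and $(1+a+b+c)_3\equiv1\pmod3$; (4) $(a,b)\in\{(2,16),(5,7),(8,25),(11,16),(14,7),(17,25),(20,16),(23,7),(26,25)\}\pmod{27}$ and $a+b\equiv c+1\pmod{81}$. Then $3$ is a common index divisor of $K$, and $\nu_3(i(K))=1$. In particular, $K$ is not monogenic.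
   Context: For a prime $p$ and a nonzero integer $m$, $\nu_p(m)$ is the $p$-adic valuation and $m_p:=m/p^{\nu_p(m)}$. Pairs congruent ''mod $n$'' to a listed set means componentwise congruence to one of the listed pairs. For a number field $K$ with ring of integers $\mathcal{O}_K$, $i(K)=\gcd\{[\mathcal{O}_K:\mathbb{Z}[\theta]]:\theta\in\mathcal{O}_K,\ K=\mathbb{Q}(\theta)\}$; a prime dividing $i(K)$ is a common index divisor of $K$. $K$ is monogenic if $\mathcal{O}_K=\mathbb{Z}[\theta]$ for some $\theta\in\mathcal{O}_K$. *)

(* Defs.v *)
(* number fields are realised inside algC (algebraic complex numbers). *)
From HB Require Import structures.
From mathcomp Require Import all_boot all_order all_algebra all_field.
Set Implicit Arguments. Unset Strict Implicit. Unset Printing Implicit Defensive.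
Import Order.TTheory GRing.Theory Num.Theory.
Local Open Scope ring_scope.

(* p-adic valuation of a nonzero integer (value irrelevant at 0; zero cases
   are handled explicitly in the statement). *)
Definition nu (p : nat) (m : int) : nat := logn p `|m|%N.
Definition ppart (p : nat) (m : int) : int := (m %/ (p ^ nu p m)%N%:Z)%Z.

Definition Qadj (t : algC) (x : algC) : Prop :=
  exists f : {poly rat}, x = (map_poly ratr f).[t].
Definition Zadj (t : algC) (x : algC) : Prop :=
  exists f : {poly int}, x = (map_poly intr f).[t].

Definition OK (alpha x : algC) : Prop := Qadj alpha x /\ x \in Aint.

Definition generator (alpha theta : algC) : Prop :=
  OK alpha theta /\ forall x, Qadj alpha x <-> Qadj theta x.

(* [O_K : Z[theta]] = n : the additive quotient O_K / Z[theta] has exactly n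
   classes, i.e. there are n elements of O_K pairwise incongruent modulo
   Z[theta] and representing every class. *)
Definition has_index (alpha theta : algC) (n : nat) : Prop :=
  exists s : seq algC,
    [/\ size s = n,
        forall y, y \in s -> OK alpha y,
        forall i j, (i < n)%N -> (j < n)%N ->
          Zadj theta (s`_i - s`_j) -> i = j
      & forall x, OK alpha x -> exists2 y, y \in s & Zadj theta (x - y)].

Definition is_common_index (alpha : algC) (g : nat) : Prop :=
  (forall theta n, generator alpha theta -> has_index alpha theta n -> (g %| n)%N) /\
  (forall d : nat, (forall theta n, generator alpha theta -> has_index alpha theta n ->
                     (d %| n)%N) -> (d %| g)%N).

Definition monogenic (alpha : algC) : Prop :=
  exists theta, OK alpha theta /\ forall x, OK alpha x -> Zadj theta x.

Definition quartF (a b c : int) : {poly int} :=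
  'X^4 + a%:P * 'X^3 + b%:P * 'X + c%:P.

(* Main.v *)
Require Import Defs.
From HB Require Import structures.
From mathcomp Require Import all_boot all_order all_algebra all_field.
From mathcomp Require Import all_fingroup all_solvable.
From mathcomp Require Import zify ring.
From Stdlib Require Import Classical.
Import Order.TTheory GRing.Theory Num.Theory.
Local Open Scope ring_scope.

Set Implicit Arguments.
Unset Strict Implicit.
Unset Printing Implicit Defensive.

(* All four sets of congruences force 3 to split completely in [K]: after translating and
   rescaling, the Newton polygon of [F] at 3 has residual polynomials with simple roots,
   so Hensel's lemma gives four 3-adic roots, approximated here by integers [r_i] with
   [F = prod (X - r_i)] modulo a high power of 3.

   The Lagrange basis elements [prod_(j != i) (alpha - r_j) / 3^k_i] are then integral,
   and up to a factor prime to 3 they are orthogonal idempotents [e_0, ..., e_3] modulo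
   [9 O_K]; a trace computation shows that they do not lie in [3 O_K].  Set
   [theta = e_1 + 2 e_2 + 3 e_3].  Multiplying by each [e_j] shows that
   [1, theta, theta (theta - 1), theta (theta - 1) (theta - 2) / 3] is a basis of [O_K]
   locally at 3, so that the index of [Z[theta]] has 3-adic valuation at most 1.
   Conversely, among the four residues in [F_3] of any integral generator two coincide,
   hence 3 divides every index. *)

(** Every argument is a congruence in [Aint] modulo 3 or 9, the idempotents standing in for the four
    primes above 3. The modulus is 9 because the last basis element has denominator 3: after
    division by 3 a congruence modulo 3 must remain. The values 0, 1, 2, 3 of [theta] on the
    idempotents account for the exponent 1: four residues in a field of three elements must collide,
    and here only 0 and 3 do, with a difference of valuation exactly one. The gcd defining i(K) says
    something only if some generator has a finite index, so finiteness of O_K / Z[theta] has to be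
    established as well. Genuine 3-adic numbers are avoided: for every precision [N] there are four
    integers that are roots of F modulo 3^N, and their mutual 3-adic distance is bounded by a [K]
    independent of [N]. All the divisions together lose a precision that depends on [K] alone, so
    [N] can be fixed afterwards. *)

Local Notation pQ := (map_poly (ratr : rat -> algC)).
Local Notation pZ := (map_poly (intr : int -> algC)).

Lemma pQ_intr (p : {poly int}) : pQ (map_poly intr p) = pZ p.
Proof. by rewrite -map_poly_comp; apply: eq_map_poly => z /=; rewrite ratr_int. Qed.

(** * Closure properties of Z[t] and Q(t) *)

Lemma Zadj_self t : Zadj t t.
Proof. by exists 'X; rewrite map_polyX hornerX. Qed.

Lemma Zadj_int t (z : int) : Zadj t z%:~R.
Proof. by exists z%:P; rewrite map_polyC hornerC. Qed.

Lemma Zadj1 t : Zadj t 1.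
Proof. exact: (Zadj_int t 1). Qed.

Lemma Zadj0 t : Zadj t 0.
Proof. exact: (Zadj_int t 0). Qed.

Lemma ZadjD t x y : Zadj t x -> Zadj t y -> Zadj t (x + y).
Proof. by move=> [f ->] [g ->]; exists (f + g); rewrite rmorphD hornerD. Qed.

Lemma ZadjM t x y : Zadj t x -> Zadj t y -> Zadj t (x * y).
Proof. by move=> [f ->] [g ->]; exists (f * g); rewrite rmorphM hornerM. Qed.

Lemma ZadjN t x : Zadj t x -> Zadj t (- x).
Proof. by move=> [f ->]; exists (- f); rewrite rmorphN hornerN. Qed.

Lemma ZadjB t x y : Zadj t x -> Zadj t y -> Zadj t (x - y).
Proof. by move=> Zx Zy; apply/ZadjD/ZadjN. Qed.

Lemma Zadj_sum t (I : Type) (r : seq I) (P : pred I) (F : I -> algC) :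
  (forall i, P i -> Zadj t (F i)) -> Zadj t (\sum_(i <- r | P i) F i).
Proof. by move=> ZF; elim/big_ind: _ => [||//]; [exact: Zadj0 | exact: ZadjD]. Qed.

Lemma Zadj_Qadj t x : Zadj t x -> Qadj t x.
Proof. by move=> [f ->]; exists (map_poly intr f); rewrite pQ_intr. Qed.

Lemma Zadj_Aint t x : t \in Aint -> Zadj t x -> x \in Aint.
Proof.
move=> At [f ->]; rewrite horner_coef rpred_sum // => i _.
by rewrite coef_map rpredM ?rpredX // Aint_int.
Qed.

Lemma Qadj_self t : Qadj t t.
Proof. exact/Zadj_Qadj/Zadj_self. Qed.

Lemma Qadj_int t (z : int) : Qadj t z%:~R.
Proof. exact/Zadj_Qadj/Zadj_int. Qed.

Lemma Qadj_rat t (z : rat) : Qadj t (ratr z).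
Proof. by exists z%:P; rewrite map_polyC hornerC. Qed.

Lemma QadjD t x y : Qadj t x -> Qadj t y -> Qadj t (x + y).
Proof. by move=> [f ->] [g ->]; exists (f + g); rewrite rmorphD hornerD. Qed.

Lemma QadjM t x y : Qadj t x -> Qadj t y -> Qadj t (x * y).
Proof. by move=> [f ->] [g ->]; exists (f * g); rewrite rmorphM hornerM. Qed.

Lemma QadjN t x : Qadj t x -> Qadj t (- x).
Proof. by move=> [f ->]; exists (- f); rewrite rmorphN hornerN. Qed.

Lemma QadjB t x y : Qadj t x -> Qadj t y -> Qadj t (x - y).
Proof. by move=> Zx Zy; apply/QadjD/QadjN. Qed.

Lemma Qadj_sum t (I : Type) (r : seq I) (P : pred I) (F : I -> algC) :
  (forall i, P i -> Qadj t (F i)) -> Qadj t (\sum_(i <- r | P i) F i).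
Proof. by move=> ZF; elim/big_ind: _ => [||//]; [exact: (Qadj_int t 0) | exact: QadjD]. Qed.

Lemma Qadj_divz t x (z : int) : Qadj t x -> Qadj t (x / z%:~R).
Proof.
move=> Qx; apply: QadjM => //.
by rewrite -[z%:~R]ratr_int -fmorphV; apply: Qadj_rat.
Qed.

Lemma Qadj_trans t u x : Qadj t u -> Qadj u x -> Qadj t x.
Proof. by move=> [g ->] [f ->]; exists (f \Po g); rewrite map_comp_poly horner_comp. Qed.

(** * Conjugates *)

Lemma minCpoly_irreducible t (p : {poly rat}) :
  minCpoly t = pQ p -> irreducible_poly p.
Proof.
move=> Dp; have [q [Dq mon_q] min_q] := minCpolyP t.
have ->: p = q by apply: (map_poly_inj (ratr : {rmorphism rat -> algC})); rewrite -Dp.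
split=> [|u su /dvdpP[v Dv]].
  by rewrite -(size_map_poly (ratr : {rmorphism rat -> algC})) -Dq size_minCpoly.
have nzq := monic_neq0 mon_q.
have /andP[nzv nzu]: (v != 0) && (u != 0).
  by rewrite -negb_or -mulf_eq0 -Dv.
have: root (pQ q) t by rewrite min_q.
rewrite {1}Dv rmorphM rootM !min_q => /orP[] /dvdp_leq.
  move/(_ nzv); rewrite Dv size_mul // => le1.
  by move: nzu nzv su le1; rewrite -!size_poly_eq0; lia.
move/(_ nzu) => le_qu; have dvd_uq: u %| q by rewrite Dv dvdp_mulIr.
by rewrite -dvdp_size_eqp // eqn_leq dvdp_leq.
Qed.

Lemma minCpoly_irr t (p : {poly rat}) : p \is monic -> irreducible_poly p ->
  root (pQ p) t -> minCpoly t = pQ p.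
Proof.
move=> mon_p irr_p; have [q [Dq mon_q] ->] := minCpolyP t => dvd_qp.
have sq: size q != 1 by rewrite neq_ltn (minCpoly_irreducible Dq).1 orbT.
by have := irr_p.2 q sq dvd_qp; rewrite eqp_monic // => /eqP <-.
Qed.

Lemma minCpoly_dvdp t (p g : {poly rat}) : minCpoly t = pQ p ->
  root (pQ g) t = (p %| g).
Proof.
move=> Dp; have [q [Dq _] ->] := minCpolyP t.
by have ->: p = q by apply: (map_poly_inj (ratr : {rmorphism rat -> algC})); rewrite -Dp.
Qed.

(** If [m] is the minimal polynomial of g(t), then m(g(X)) vanishes at [t], hence is divisible by
    the minimal polynomial of [t], hence vanishes at [u]: g(u) is a root of the monic integral
    [m]. *)
Lemma conjugate_Aint t u (g : {poly rat}) : root (minCpoly t) u ->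
  (pQ g).[t] \in Aint -> (pQ g).[u] \in Aint.
Proof.
have [p [Dp mon_p] min_p] := minCpolyP t => ru Ax.
have [m [Dm mon_m] min_m] := minCpolyP (pQ g).[t].
have: root (pQ (m \Po g)) t.
  by rewrite map_comp_poly /root horner_comp -Dm; apply: root_minCpoly.
rewrite min_p => /dvdpP[v Dv].
have: root (pQ (m \Po g)) u by rewrite Dv rmorphM rootM /= -Dp ru orbT.
rewrite map_comp_poly /root horner_comp -Dm => rm.
by apply: root_monic_Aint rm (minCpoly_monic _) _.
Qed.

(** In characteristic 0 the derivative is non-zero of smaller degree, hence coprime to the
    irreducible polynomial. This makes the Vandermonde determinant of the conjugates invertible. *)
Lemma minCpoly_uniq_roots t (rs : seq algC) :
  minCpoly t = \prod_(r <- rs) ('X - r%:P) -> uniq rs.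
Proof.
have [p [Dp mon_p] _] := minCpolyP t; have irr_p := minCpoly_irreducible Dp.
move=> Drs; rewrite -separable_prod_XsubC -Drs Dp separable_map.
rewrite unlock irreducible_poly_coprime //.
apply/negP => /dvdp_leq le_p.
have nzp' : p^`() != 0.
  have [+ _] := irr_p; case Dn: (size p) => [|[|n]] // _.
  apply/eqP=> /polyP/(_ n)/eqP; rewrite coef_deriv coef0.
  by have := monicP mon_p; rewrite lead_coefE Dn /= => ->; rewrite pnatr_eq0.
by have := lt_size_deriv (monic_neq0 mon_p); rewrite ltnNge le_p.
Qed.

(** The constant term of the minimal polynomial is a multiple of [y]: writing P = X Q + P_0 gives -
    P_0 / y = Q(y), which is integral. *)
Lemma Aint_dvd_int y : y \in Aint -> y != 0 ->
  exists2 D : int, D != 0 & D%:~R / y \in Aint.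
Proof.
move=> Ay nzy; have [p [Dp mon_p] min_p] := minCpolyP y.
have /floorpP[P DP] := Ay; have irr_p := minCpoly_irreducible Dp.
have Pe: P = 'X * (\poly_(i < (size P).-1) P`_i.+1) + (P`_0)%:P.
  apply/polyP=> -[|i]; rewrite coefD coefXM coefC /= ?add0r // addr0 coef_poly.
  by case: ltnP => // le_i; rewrite nth_default //; move: le_i; case: (size P).
set Q := \poly_(i < _) _ in Pe; exists (- P`_0).
  (* With zero constant term, [y] would be a root of [Q], non-zero and of smaller degree than the
     minimal polynomial. *)
  rewrite oppr_eq0; apply/eqP=> P0.
  have sP: size P = size p.
    rewrite -(size_map_poly (ratr : {rmorphism rat -> algC})) -Dp DP.
    by rewrite size_map_inj_poly //; apply: intr_inj.
  have: root (pQ (map_poly intr Q)) y.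
    have := root_minCpoly y; rewrite pQ_intr DP {1}Pe P0 addr0 rmorphM rootM /= map_polyX.
    by rewrite rootX (negPf nzy).
  rewrite min_p => /dvdp_leq; rewrite (size_map_inj_poly (@intr_inj _)) //.
  have sQ: (size Q <= (size P).-1)%N by apply: size_poly.
  move=> /(_ _)/leq_trans/(_ sQ); rewrite sP.
  have sp := irr_p.1.
  have nzQ: (map_poly intr Q : {poly rat}) != 0.
    rewrite -size_poly_eq0 (size_map_inj_poly (@intr_inj _)) // size_poly_eq0.
    apply/eqP=> Q0; move: sP; rewrite Pe Q0 P0 mulr0 addr0 size_poly0.
    by move: sp; case: (size p).
  by move=> /(_ nzQ); move: sp; case: (size p) => // n _; rewrite ltnn.
have: (pZ P).[y] = 0 by rewrite -DP; apply/eqP/(root_minCpoly y).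
rewrite {1}Pe rmorphD rmorphM /= map_polyX map_polyC hornerD hornerM hornerX hornerC.
move/eqP; rewrite addr_eq0 => /eqP E; rewrite rmorphN -E mulrAC mulfV // mul1r.
by apply: (Zadj_Aint Ay); exists Q.
Qed.

Lemma Aint_det n (M : 'M[algC]_n) : (forall i j, M i j \in Aint) -> \det M \in Aint.
Proof.
move=> AM; rewrite rpred_sum // => s _; rewrite rpredMsign rpred_prod //.
Qed.

Lemma Aint_adj n (M : 'M[algC]_n) i j :
  (forall i j, M i j \in Aint) -> (\adj M) i j \in Aint.
Proof.
move=> AM; rewrite mxE /cofactor rpredMsign; apply: Aint_det => k l.
by rewrite !mxE.
Qed.

(* Cramer's rule on the Vandermonde system of the conjugates of [t]. *)
Lemma OK_denom t (p : {poly rat}) : t \in Aint -> minCpoly t = pQ p ->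
  exists2 D : int, D != 0 &
    forall g : {poly rat}, (size g < size p)%N -> (pQ g).[t] \in Aint ->
      exists G : {poly int}, D%:~R *: g = map_poly intr G.
Proof.
move=> At Dp; have [rs Drs] := closed_field_poly_normal (minCpoly t).
rewrite (monicP (minCpoly_monic t)) scale1r in Drs.
have uniq_rs := minCpoly_uniq_roots Drs.
set n := size rs; have sp: size p = n.+1.
  by rewrite -(size_map_poly (ratr : {rmorphism rat -> algC})) -Dp Drs size_prod_XsubC.
have rootrs r : r \in rs -> root (minCpoly t) r by rewrite Drs root_prod_XsubC.
have Ars r : r \in rs -> r \in Aint.
  move=> /rootrs rr; rewrite -[r]hornerX -(map_polyX (ratr : {rmorphism rat -> algC})).
  by apply: conjugate_Aint rr _; rewrite map_polyX hornerX.
pose V := Vandermonde n (\row_(j < n) rs`_j).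
have AV i j : V i j \in Aint by rewrite !mxE rpredX // Ars // mem_nth.
have nzV: \det V != 0.
  rewrite det_Vandermonde; apply/prodf_neq0 => i _; apply/prodf_neq0 => j ltij.
  by rewrite !mxE subr_eq0 nth_uniq // neq_ltn ltij orbT.
have [D nzD AD] := Aint_dvd_int (Aint_det AV) nzV.
exists D => // g; rewrite sp ltnS => sg Ag.
suffices Zg i : (D%:~R * g`_i : rat) \is a Num.int.
  suffices /floorpP[G ->]: D%:~R *: g \is a polyOver Num.int by exists G.
  by apply/polyOverP=> i; rewrite coefZ.
have [le_ni|lt_in] := leqP n i.
  by rewrite nth_default ?mulr0 ?(leq_trans sg).
pose c := \row_(j < n) (ratr g`_j : algC); pose x := \row_(j < n) (pQ g).[rs`_j].
have cV: c *m V = x.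
  apply/rowP=> j; rewrite !mxE (@horner_coef_wide _ n) ?size_map_poly //.
  by apply: eq_bigr => k _; rewrite !mxE coef_map.
have: \det V *: c = x *m \adj V by rewrite -cV -mulmxA mul_mx_adj mul_mx_scalar.
move=> /rowP/(_ (Ordinal lt_in)); rewrite !mxE /= => Ec.
(* Multiplying by D / det V, which is integral, replaces the possibly irrational determinant by the
   integer [D]. The resulting number is both rational and integral. *)
have: D%:~R / \det V * (\det V * ratr g`_i) \in Aint.
  rewrite Ec rpredM // rpred_sum // => k _; rewrite rpredM ?Aint_adj //.
  by rewrite mxE; apply: conjugate_Aint Ag; apply/rootrs/mem_nth.
rewrite mulrA divfK // -ratr_int -rmorphM => /(Cint_rat_Aint (Crat_rat _)).
by rewrite Cint_rat.
Qed.

Lemma pZ_eq0 t (p : {poly rat}) (f : {poly int}) : minCpoly t = pQ p ->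
  (size f < size p)%N -> (pZ f).[t] = 0 -> f = 0.
Proof.
move=> Dp sf /eqP; rewrite -pQ_intr -[_ == 0]/(root _ t) (minCpoly_dvdp _ Dp).
have [-> //|nzf] := eqVneq f 0.
have sE: size (map_poly intr f : {poly rat}) = size f.
  by rewrite size_map_inj_poly //; apply: intr_inj.
move/dvdp_leq; rewrite -size_poly_eq0 sE size_poly_eq0 => /(_ nzf).
by rewrite leqNgt sf.
Qed.

Lemma Zadj_reduce t (p : {poly rat}) x : t \in Aint -> minCpoly t = pQ p ->
  Zadj t x -> exists2 f : {poly int}, (size f < size p)%N & x = (pZ f).[t].
Proof.
move=> At Dp [f ->]; have /floorpP[P DP] := At.
have monP : P \is monic.
  apply/eqP/(@intr_inj algC); rewrite -(lead_coef_map_inj (@intr_inj algC)) //.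
  by rewrite -DP (monicP (minCpoly_monic t)).
exists (Pdiv.CommonRing.rmodp f P).
  have ->: size p = size P.
    rewrite -(size_map_poly (ratr : {rmorphism rat -> algC})) -Dp DP.
    by rewrite size_map_inj_poly //; apply: intr_inj.
  by rewrite Pdiv.CommonRing.ltn_rmodpN0 // monic_neq0.
rewrite {1}(Pdiv.RingMonic.rdivp_eq monP f) rmorphD rmorphM hornerD hornerM /= -DP.
by rewrite (eqP (root_minCpoly t)) mulr0 add0r.
Qed.

Lemma Qadj_reduce t (p : {poly rat}) x : minCpoly t = pQ p ->
  Qadj t x -> exists2 f : {poly rat}, (size f < size p)%N & x = (pQ f).[t].
Proof.
move=> Dp [f ->]; have nzp: p != 0.
  by apply: contra_eq_neq Dp => ->; rewrite rmorph0 minCpoly_eq0.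
exists (f %% p); first by rewrite ltn_modp.
rewrite {1}(divp_eq f p) rmorphD rmorphM hornerD hornerM /= -Dp.
by rewrite (eqP (root_minCpoly t)) mulr0 add0r.
Qed.

(** All of O_K lies in the span of the t^j / q for a suitable [q], so the quotient by Z[t] is the
    subgroup of (Z/q)^n formed by the coordinate vectors of integral elements. The map [e] picks
    lifts between 0 and q - 1 and is therefore additive only modulo Z[t]; row vectors carry addition
    as their group law, written multiplicatively. *)
Lemma finite_quotient t : t \in Aint ->
  exists (gT : finGroupType) (G : {group gT}) (e : gT -> algC),
    [/\ forall g, g \in G -> OK t (e g),
        forall g h, g \in G -> h \in G -> Zadj t (e (g * h)%g - e g - e h),
        forall g h, g \in G -> h \in G -> Zadj t (e g - e h) -> g = h
      & forall x, OK t x -> exists2 g, g \in G & Zadj t (x - e g)].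
Proof.
move=> At; have [p [Dp mon_p] _] := minCpolyP t.
have [D nzD denD] := OK_denom At Dp.
(* The factor 2 ensures q > 1, without which ['Z_q] would not be Z/q. *)
set q := (2 * `|D|)%N; have q_gt1: (1 < q)%N by rewrite /q; lia.
have nzq: (q%:R : algC) != 0 by rewrite pnatr_eq0; lia.
set n := (size p).-1; have sp: size p = n.+1.
  by rewrite prednK // size_poly_gt0 monic_neq0.
pose gT := 'rV['Z_q]_n.
pose S (c : 'I_n -> int) := \sum_(j < n) (c j)%:~R * t ^+ j.
pose e (v : gT) : algC := S (fun j => (v 0 j : nat)%:Z) / q%:R.
have ZS c : Zadj t (S c).
  exists (\poly_(j < n) (if insub j is Some i then c i else 0)).
  rewrite (@horner_coef_wide _ n); last first.
    by rewrite (leq_trans (size_poly _ _)) //; apply: size_poly.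
  by apply: eq_bigr => i _; rewrite coef_map coef_poly ltn_ord valK.
have SB c d : S c - S d = S (fun j => c j - d j).
  rewrite -sumrB; apply: eq_bigr => j _; rewrite rmorphB mulrBl //.
have SZ k c : k%:~R * S c = S (fun j => k * c j).
  by rewrite mulr_sumr; apply: eq_bigr => j _; rewrite rmorphM mulrA.
have eqS c d : (forall j, c j = d j) -> S c = S d.
  by move=> E; apply: eq_bigr => j _; rewrite E.
have S0 c : S c = 0 -> forall j, c j = 0.
  pose f := \poly_(j < n) (if insub j is Some i then c i else 0).
  move=> Sc0; have f0: f = 0.
    apply: (pZ_eq0 Dp); first by rewrite sp ltnS size_poly.
    rewrite -[RHS]Sc0 (@horner_coef_wide _ n); last first.
      by rewrite (leq_trans (size_poly _ _)) //; apply: size_poly.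
    by apply: eq_bigr => i _; rewrite coef_map coef_poly ltn_ord valK.
  move=> j; have := congr1 (fun h : {poly int} => h`_j) f0.
  by rewrite coef_poly ltn_ord valK coef0.
have Scong c d : (forall j, (c j == d j %[mod q%:Z])%Z) ->
    Zadj t (S c / q%:R - S d / q%:R).
  move=> cong; rewrite -mulrBl SB.
  suffices ->: S (fun j => c j - d j) = q%:~R * S (fun j => ((c j - d j) %/ q%:Z)%Z).
    by rewrite mulrAC mulfV // mul1r; apply: ZS.
  rewrite SZ; apply: eqS => j.
  by rewrite mulrC divzK // -eqz_mod_dvd.
(* An element of Z[t] is an integral combination of the t^j with j < n, and these are independent,
   so coefficients can be compared. *)
have Sinj c d : Zadj t (S c / q%:R - S d / q%:R) ->
    forall j, (c j == d j %[mod q%:Z])%Z.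
  rewrite -mulrBl SB => /(Zadj_reduce At Dp)[f sf Ef] j.
  have: S (fun j => c j - d j - q%:Z * f`_j) = 0.
    rewrite -SB -SZ; apply/eqP; rewrite subr_eq0; apply/eqP.
    rewrite -[LHS](divfK nzq) Ef mulrC; congr (_ * _).
    rewrite (@horner_coef_wide _ n); last first.
      by rewrite (leq_trans (size_poly _ _)) // -ltnS -sp.
    by apply: eq_bigr => i _; rewrite coef_map.
  move/S0/(_ j)/eqP; rewrite subr_eq0 => /eqP Ej.
  by rewrite eqz_mod_dvd Ej dvdz_mulr.
have Zq : (Zp_trunc q).+2 = q by apply: Zp_cast.
pose Gs := [set v : gT | e v \in Aint].
have eD v w : Zadj t (e (v * w)%g - e v - e w).
  rewrite -addrA -opprD -mulrDl.
  have ->: S (fun j => (v 0 j : nat)%:Z) + S (fun j => (w 0 j : nat)%:Z)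
     = S (fun j => (v 0 j : nat)%:Z + (w 0 j : nat)%:Z).
    by rewrite -big_split; apply: eq_bigr => j _; rewrite rmorphD mulrDl.
  apply: Scong => j; rewrite mxE /= [in X in (_ %% X)%N]Zq.
  by rewrite -PoszD -modz_nat modz_mod.
have Ggr : group_set Gs.
  apply/group_setP; split.
    rewrite inE /e /S big1 ?mul0r // => j _; rewrite mxE /= mul0r //.
  move=> v w; rewrite !inE => Av Aw.
  have := Zadj_Aint At (eD v w) => Avw.
  have ->: e (v * w)%g = e (v * w)%g - e v - e w + (e v + e w) by ring.
  by apply: rpredD Avw _; apply: rpredD.
have Qe v : Qadj t (e v).
  by have := Qadj_divz q%:Z (Zadj_Qadj (ZS (fun j => (v 0 j : nat)%:Z))).
exists gT, (group Ggr), e; split.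
- by move=> v; rewrite inE => Av; split.
- by move=> v w _ _; apply: eD.
- move=> v w _ _ /Sinj E; apply/rowP=> j; apply/val_inj; have := E j => /=.
  rewrite !modz_nat -[(_ == _ :> int)]/(_ == _ :> nat).
  by rewrite !modn_small -?[X in (_ < X)%N]Zq ?ltn_ord // => /eqP.
move=> x [Qx Ax]; have [g sg Dx] := Qadj_reduce Dp Qx.
have [H DH] := denD g sg ltac:(by rewrite -Dx).
(* Since [H] is [D] times [g], these are the coefficients of q g; the sign turns [D] into its
   absolute value. *)
pose c (j : 'I_n) := 2 * (-1) ^+ (D < 0)%R * H`_j.
have Ex : x = S c / q%:R.
  apply: (canRL (mulfK nzq)).
  have qD : (q%:R : rat) = 2%:R * (-1) ^+ (D < 0)%R * D%:~R.
    rewrite /q natrM -mulrA; congr (_ * _).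
    by rewrite -[in RHS](intr_sign rat) -intrM -abszEsign.
  rewrite Dx mulrC (@horner_coef_wide _ n); last first.
    by rewrite size_map_poly -ltnS -sp.
  rewrite mulr_sumr; apply: eq_bigr => j _; rewrite mulrA; congr (_ * _).
  rewrite coef_map /= -(rmorph_nat (ratr : {rmorphism rat -> algC})) -rmorphM /=.
  rewrite qD -[_ * g`_j]mulrA; have := congr1 (fun h : {poly rat} => h`_j) DH.
  rewrite coefZ coef_map /= => ->.
  rewrite /c !rmorphM /= !rmorph_sign /= ratr_int; congr (_ * _ * _).
  by rewrite rmorph_nat.
pose v : gT := \row_j ((`|(c j %% q%:Z)%Z|%N)%:R : 'Z_q).
have xv : Zadj t (x - e v).
  rewrite Ex; apply: Scong => j; rewrite mxE val_Zp_nat //.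
  have c_ge0 : (0 <= (c j %% q%:Z)%Z)%R by apply: modz_ge0; lia.
  by rewrite -modz_nat gez0_abs // !modz_mod.
exists v => //; rewrite inE.
have := Zadj_Aint At xv => Axv.
by rewrite -(subKr x (e v)) rpredB.
Qed.

(** * Indices *)

(** As [S] is an arbitrary predicate, the gcd is reached by descent: a member [m] not divisible by
    [n] makes gcd(n, m) smaller than [n], and adjoining it to [S] does not change the common
    divisors. *)
Lemma gcd_exists (S : nat -> Prop) n : (0 < n)%N -> S n ->
  exists2 g, forall m, S m -> (g %| m)%N &
    forall d, (forall m, S m -> (d %| m)%N) -> (d %| g)%N.
Proof.
have [k] := ubnP n; elim: k => // k IHk in n S *; rewrite ltnS => le_nk n_gt0 Sn.
case: (classic (forall m, S m -> (n %| m)%N)) => [nS|/not_all_ex_not].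
  by exists n => // d; apply.
case=> m nSm; have [Sm /negP ndv] := imply_to_and _ _ nSm.
have lt_gn : (gcdn n m < n)%N.
  rewrite ltn_neqAle dvdn_leq ?dvdn_gcdl // andbT.
  by apply: contraNneq ndv => <-; apply: dvdn_gcdr.
have [] := IHk (gcdn n m) (fun x => S x \/ x = gcdn n m).
- exact: leq_trans lt_gn le_nk.
- by rewrite gcdn_gt0 n_gt0.
- by right.
move=> g gS gmax; exists g => [x Sx|d dS]; first by apply: gS; left.
by apply: gmax => x [/dS //|->]; rewrite dvdn_gcd !dS.
Qed.

Lemma ZadjMn t x (k : nat) : Zadj t x -> Zadj t (k%:R * x).
Proof. by move=> Zx; apply: ZadjM Zx; apply: (Zadj_int t k). Qed.

(* Translation by [x] permutes the classes, so summing representatives gives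
   Lagrange's theorem for the quotient. *)
Lemma index_mul alpha t n x : has_index alpha t n -> OK alpha x -> Zadj t (n%:R * x).
Proof.
move=> [s [ss OKs inj_s sur_s]] [Qx Ax].
have sP (i : 'I_n) : exists j : 'I_n, Zadj t (s`_i + x - s`_j).
  have [Qi Ai]: OK alpha s`_i by apply/OKs/mem_nth; rewrite ss.
  have [|y ys Zy] := sur_s (s`_i + x); first by split; [apply: QadjD|rewrite rpredD].
  have lt_j: (index y s < n)%N by rewrite -ss index_mem.
  by exists (Ordinal lt_j); rewrite /= nth_index.
have [f fP] := fin_all_exists sP.
have f_inj : injective f.
  move=> i j eq_f; have Zij : Zadj t (s`_i - s`_j).
    have ->: s`_i - s`_j = (s`_i + x - s`_(f i)) - (s`_j + x - s`_(f j)).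
      by rewrite eq_f; ring.
    exact: ZadjB.
  exact/val_inj/(inj_s _ _ (ltn_ord i) (ltn_ord j) Zij).
have: Zadj t (\sum_(i < n) (s`_i + x - s`_(f i))) by apply: Zadj_sum => i _.
rewrite sumrB big_split /= [X in _ - X](_ : _ = \sum_(i < n) s`_i).
  by rewrite sumr_const card_ord addrAC subrr add0r mulr_natl.
by rewrite [RHS](reindex_inj f_inj).
Qed.

Section Quotient.

Variables (alpha t : algC) (gT : finGroupType) (G : {group gT}) (e : gT -> algC).
Hypotheses
  (eOK : forall g, g \in G -> OK alpha (e g))
  (eM : forall g h, g \in G -> h \in G -> Zadj t (e (g * h)%g - e g - e h))
  (e_inj : forall g h, g \in G -> h \in G -> Zadj t (e g - e h) -> g = h)
  (e_sur : forall x, OK alpha x -> exists2 g, g \in G & Zadj t (x - e g)).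

Lemma quotient_has_index : has_index alpha t #|G|.
Proof.
exists [seq e g | g <- enum G]; split.
- by rewrite size_map -cardE.
- by move=> y /mapP[g]; rewrite mem_enum => Gg ->; apply: eOK.
- rewrite cardE => i j lti ltj; rewrite !(nth_map 1%g) // => /e_inj.
  rewrite -!(mem_enum G) !mem_nth // => /(_ isT isT)/eqP.
  by rewrite nth_uniq ?enum_uniq // => /eqP.
move=> x /e_sur[g Gg Zg]; exists (e g) => //.
by rewrite map_f // mem_enum.
Qed.

Lemma quotient_exp g k : g \in G -> Zadj t (e (g ^+ k)%g - k%:R * e g).
Proof.
move=> Gg; have Z1 : Zadj t (e 1%g).
  by have /ZadjN := eM (group1 G) (group1 G); rewrite mulg1 subrr sub0r opprK.
elim: k => [|k IHk]; first by rewrite expg0 mul0r subr0.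
have := ZadjD IHk (eM Gg (groupX k Gg)); rewrite -expgS.
by congr (Zadj t _); rewrite -natr1; ring.
Qed.

(** The class of [h] has order dividing 3, and every class becomes a multiple of it after
    multiplication by an integer prime to 3. On the Sylow 3-subgroup such a multiplication is
    invertible, so that subgroup lies in the cyclic group generated by [h]. *)
Lemma quotient_logn3 h : OK alpha h -> Zadj t (3%:R * h) ->
    (forall x, OK alpha x ->
       exists m k : int, ~~ (3 %| m)%Z /\ Zadj t (m%:~R * x - k%:~R * h)) ->
  (logn 3 #|G| <= 1)%N.
Proof.
move=> OKh Z3h gen; have [g0 Gg0 Zg0] := e_sur OKh.
have g3 : (g0 ^+ 3 = 1)%g.
  apply: e_inj; rewrite ?group1 ?groupX //.
  have := ZadjB (quotient_exp 3 Gg0) (quotient_exp 0 Gg0).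
  have := ZadjB Z3h (ZadjMn 3 Zg0); rewrite expg0 => Za Zb.
  by have := ZadjD Za Zb; congr (Zadj t _); ring.
have [P sylP] := Sylow_exists 3 G; have [sPG p3P _] := and3P sylP.
have sPg : P \subset <[g0]>%g.
  apply/subsetP=> x Px; have Gx := subsetP sPG x Px.
  have [m [k [m3 Zmk]]] := gen _ (eOK Gx).
  (* Group powers need natural exponents: the sign of [m] is moved to [k], which is then reduced
     modulo 3. The discarded multiple of 3 h lies in Z[t]. *)
  pose k' := (((-1) ^+ (m < 0)%R * k) %% 3)%Z.
  have k'_ge0 : (0 <= k')%R by apply: modz_ge0.
  have Zmk' : Zadj t (`|m|%N%:R * e x - `|k'|%N%:R * h).
    rewrite !natr_absz (ger0_norm k'_ge0).
    have ->: `|m|%:~R * e x - k'%:~R * h = ((-1) ^+ (m < 0)%R) * (m%:~R * e x - k%:~R * h)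
       + (((-1) ^+ (m < 0)%R * k) %/ 3)%Z%:~R * (3%:R * h).
      rewrite (normrEsign m) intrM -[k'](addKr ((((-1) ^+ (m < 0)%R * k) %/ 3)%Z * 3)).
      rewrite -divz_eq !(rmorphD, rmorphN, rmorphM) /= rmorph_sign; ring.
    apply: ZadjD; apply: ZadjM => //; last exact: Zadj_int.
    by rewrite -(intr_sign algC); apply: Zadj_int.
  have xm : (x ^+ `|m| = g0 ^+ `|k'|)%g.
    apply: e_inj; rewrite ?groupX //.
    have Z1 := ZadjB (quotient_exp `|m| Gx) (quotient_exp `|k'| Gg0).
    have := ZadjD Z1 (ZadjD Zmk' (ZadjMn `|k'| Zg0)).
    by congr (Zadj t _); ring.
  (* The order of [x] is a power of 3, so x^|m| generates the same cyclic group as [x]. *)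
  have co : coprime #[x]%g `|m|.
    have [a ->] := p_natP (mem_p_elt p3P Px).
    by rewrite coprimeXl // prime_coprime //; move: m3; rewrite dvdzE.
  move: co; rewrite -generator_coprime => /eqP gx.
  by rewrite -cycle_subG gx xm cycle_subG mem_cycle.
have : (#|P| %| 3)%N.
  by apply: dvdn_trans (cardSg sPg) _; rewrite order_dvdn g3.
rewrite (card_Hall sylP) p_part => /(dvdn_leq (isT : 0 < 3)%N).
by rewrite -[X in (_ <= X)%N](expn1 3) leq_exp2l.
Qed.

End Quotient.

Lemma generator_OK alpha t x : Defs.generator alpha t -> OK alpha x <-> OK t x.
Proof. by move=> [_ E]; rewrite /OK E. Qed.

(** * Congruences between algebraic integers *)

Lemma dvdAP (q : nat) x : (0 < q)%N ->
  reflect (exists2 z, z \in Aint & x = q%:R * z) (x \in dvdA q).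
Proof.
move=> q_gt0; have nzq : (q%:R : algC) != 0 by rewrite pnatr_eq0 -lt0n.
rewrite unfold_in (negPf nzq); apply: (iffP idP) => [Ax|[z Az ->]].
  by exists (x / q%:R) => //; rewrite mulrCA mulfV // mulr1.
by rewrite mulrAC mulfV // mul1r.
Qed.

Lemma dvdA_mull (q : nat) z x : (0 < q)%N -> z \in Aint -> x \in dvdA q -> z * x \in dvdA q.
Proof.
move=> q_gt0 Az /(dvdAP _ q_gt0)[y Ay ->].
by apply/dvdAP => //; exists (z * y); [apply: rpredM | ring].
Qed.

Lemma dvdA_mulq (q : nat) z : (0 < q)%N -> z \in Aint -> q%:R * z \in dvdA q.
Proof. by move=> q_gt0 Az; apply/dvdAP => //; exists z. Qed.

Lemma dvdA_dvdn (q k : nat) x : (0 < q)%N -> (0 < k)%N -> x \in dvdA (q * k)%N -> x \in dvdA q.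
Proof.
move=> q_gt0 k_gt0 /dvdAP; rewrite muln_gt0 q_gt0 k_gt0 => /(_ isT)[z Az ->].
apply/dvdAP => //; exists (k%:R * z); last by rewrite natrM mulrA.
by rewrite rpredM // (Aint_int k).
Qed.

(** By a Bezout relation between 3 and [c], a [c] prime to 3 would force 3 to divide [y]. Applied
    with [y] one of the idempotents, this descends congruences from [Aint] to the integers. *)
Lemma dvdA3_int y (c : int) : y \in Aint -> y \notin dvdA 3%N ->
  c%:~R * y \in dvdA 3%N -> (3 %| c)%Z.
Proof.
move=> Ay ny /dvdAP[]// z Az Ez; apply: contraR ny => nc.
have /coprimezP[[u v] /= Euv] : coprimez 3 c by rewrite coprimezE prime_coprime.
apply/dvdAP => //; exists (u%:~R * y + v%:~R * z).
  by rewrite rpredD ?rpredM ?Aint_int.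
have E1 : u%:~R * 3%:R + v%:~R * c%:~R = 1 :> algC.
  by have := congr1 (intr : int -> algC) Euv; rewrite rmorphD !rmorphM.
transitivity ((u%:~R * 3%:R + v%:~R * c%:~R) * y); first by rewrite E1 mul1r.
by rewrite mulrDl -[_ * c%:~R * y]mulrA Ez; ring.
Qed.

(** If [t] acts on [y] as the scalar [c] modulo [q], then f(t) acts as f(c), because X - c divides f
    - f(c). With [y] an idempotent, this is reduction at one prime above 3. *)
Lemma eigen_horner (q : nat) t y (c : int) (f : {poly int}) : (0 < q)%N ->
  t \in Aint -> y \in Aint -> t * y - c%:~R * y \in dvdA q ->
  (pZ f).[t] * y - (f.[c])%:~R * y \in dvdA q.
Proof.
move=> q_gt0 At Ay Dt.
have /factor_theorem[g Dg] : root (f - (f.[c])%:P) c.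
  by rewrite /root hornerD hornerN hornerC subrr.
rewrite -{1}(subrK (f.[c])%:P f) Dg rmorphD rmorphM rmorphB /= map_polyX !map_polyC.
rewrite hornerD hornerM hornerD hornerN hornerX !hornerC mulrDl addrK -mulrA mulrBl.
by apply: dvdA_mull Dt => //; apply: (Zadj_Aint At); exists g.
Qed.

Lemma dvdz_horner_sub (f : {poly int}) (q x y : int) :
  (q %| x - y)%Z -> (q %| f.[x] - f.[y])%Z.
Proof.
move=> dxy; have /factor_theorem[g Dg] : root (f - (f.[y])%:P) y.
  by rewrite /root hornerD hornerN hornerC subrr.
have := congr1 (horner^~ x) Dg; rewrite hornerD hornerN hornerC => ->.
by rewrite hornerM hornerD hornerN hornerX hornerC dvdz_mull.
Qed.

Lemma int_scale n (v : 'I_n -> rat) :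
  exists2 D : int, D != 0 & exists c : 'I_n -> int, forall i, D%:~R * v i = (c i)%:~R.
Proof.
pose D := \prod_(i < n) denq (v i); exists D.
  by apply/prodf_neq0 => i _; apply: denq_neq0.
exists (fun i => \prod_(j < n | j != i) denq (v j) * numq (v i)) => i.
by rewrite /D (bigD1 i) //= !rmorphM /= numqE; ring.
Qed.

(** The coordinates of the [b i] on the powers of [alpha] form a square matrix; a rational vector in
    its kernel becomes an integral relation once denominators are cleared, so the matrix is
    invertible. *)
Lemma independent_span alpha (p : {poly rat}) n (b : 'I_n -> algC) :
    minCpoly alpha = pQ p -> size p = n.+1 -> (forall i, Qadj alpha (b i)) ->
    (forall c : 'I_n -> int, \sum_i (c i)%:~R * b i = 0 -> forall i, c i = 0) ->
  forall x, Qadj alpha x -> exists2 D : int, D != 0 &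
    exists c : 'I_n -> int, D%:~R * x = \sum_i (c i)%:~R * b i.
Proof.
move=> Dp sp Qb free_b x Qx.
have red y : Qadj alpha y -> exists u : 'rV[rat]_n, y = \sum_j ratr (u 0 j) * alpha ^+ j.
  move=> /(Qadj_reduce Dp)[g]; rewrite sp ltnS => sg ->; exists (poly_rV g).
  rewrite (@horner_coef_wide _ n) ?size_map_poly //.
  by apply: eq_bigr => j _; rewrite mxE coef_map.
have [B EB] := fin_all_exists (fun i => red _ (Qb i)).
pose M := \matrix_i B i.
have comb (v : 'rV[rat]_n) :
    \sum_i ratr (v 0 i) * b i = \sum_j ratr ((v *m M) 0 j) * alpha ^+ j.
  under eq_bigr => i _ do rewrite EB mulr_sumr.
  rewrite exchange_big /=; apply: eq_bigr => j _; rewrite mxE rmorph_sum mulr_suml.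
  by apply: eq_bigr => i _; rewrite mxE rmorphM mulrA.
have freeM : row_free M.
  apply/row_freeP; have: kermx M == 0.
    apply/eqP/row_matrixP => k; rewrite row0; set v := row k _.
    have vM : v *m M = 0 by apply/sub_kermxP; rewrite row_sub.
    have [D nzD [c Ec]] := int_scale (fun i => v 0 i).
    have c0 : forall i, c i = 0.
      apply: free_b; transitivity (D%:~R * \sum_i ratr (v 0 i) * b i).
        rewrite mulr_sumr; apply: eq_bigr => i _.
        by rewrite mulrA -(ratr_int _ D) -rmorphM /= Ec ratr_int.
      by rewrite comb vM big1 ?mulr0 // => j _; rewrite mxE rmorph0 mul0r.
    apply/rowP => i; rewrite [RHS]mxE; apply/eqP; move: (Ec i); rewrite c0 => /eqP.
    by rewrite mulf_eq0 intr_eq0 (negPf nzD).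
  by rewrite kermx_eq0 => /row_freeP.
have uM : M \in unitmx by rewrite -row_free_unit.
have [u Eu] := red _ Qx; have [D nzD [c Ec]] := int_scale (fun i => (u *m invmx M) 0 i).
exists D => //; exists c; rewrite Eu -{1}(mulmxKV uM u) -comb mulr_sumr.
by apply: eq_bigr => i _; rewrite mulrA -(ratr_int _ D) -rmorphM /= Ec ratr_int.
Qed.

(** * Complete splitting at 3 *)

Section SplitAt3.

Variables (alpha : algC) (p : {poly rat}) (e : 'I_4 -> algC).
Hypotheses (Dp : minCpoly alpha = pQ p) (sp : size p = 5).
Hypotheses (eOK : forall i, OK alpha (e i))
  (e_orth : forall i j, i != j -> e i * e j \in dvdA 9%N)
  (e_idem : forall i, e i * e i - e i \in dvdA 9%N)
  (e_n3 : forall i, e i \notin dvdA 3%N).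

Let eA i : e i \in Aint. Proof. by case: (eOK i). Qed.
Let eQ i : Qadj alpha (e i). Proof. by case: (eOK i). Qed.

Let theta := \sum_(j < 4) (j : nat)%:R * e j.

Let thetaA : theta \in Aint.
Proof. by rewrite rpred_sum // => j _; rewrite rpredM // (Aint_int j). Qed.

Let thetaQ : Qadj alpha theta.
Proof. by apply: Qadj_sum => j _; apply: QadjM => //; apply: (Qadj_int alpha j). Qed.

Let theta_e (j : 'I_4) : theta * e j - (j : nat)%:Z%:~R * e j \in dvdA 9%N.
Proof.
rewrite mulr_suml (bigD1 j) //= addrAC -mulrA -mulrBr rpredD //.
  by apply: dvdA_mull => //; apply: (Aint_int j).
rewrite rpred_sum // => i neq_ij; rewrite -mulrA; apply: dvdA_mull => //.
  exact: (Aint_int i).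
exact: e_orth.
Qed.

Let theta_horner (f : {poly int}) (j : 'I_4) :
  (pZ f).[theta] * e j - (f.[(j : nat)%:Z])%:~R * e j \in dvdA 9%N.
Proof. exact: eigen_horner. Qed.

Let f3 : {poly int} := ('X - 1%:P) * ('X - 2%:P).
Let h := theta * (theta - 1) * (theta - 2%:R) / 3%:R.

Let h3 : 3%:R * h = theta * (theta - 1) * (theta - 2%:R).
Proof. by rewrite /h; field. Qed.

Let f3E : (pZ f3).[theta] = (theta - 1) * (theta - 2%:R).
Proof.
rewrite /f3 rmorphM !rmorphB /= map_polyX !map_polyC /=.
by rewrite hornerM !hornerD !hornerN !hornerX !hornerC.
Qed.

Let f3j (j : nat) : f3.[j%:Z] = (j%:Z - 1) * (j%:Z - 2).
Proof. by rewrite /f3 hornerM !hornerD !hornerN !hornerX !hornerC. Qed.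

(** Expanding one factor [theta] over the [e j] lets the two others act by scalars: the product is
    congruent to the sum of the j (j - 1) (j - 2) e_j, whose coefficients are divisible by 3. *)
Let hA : h \in Aint.
Proof.
suffices /dvdAP[//|z Az Ez] : 3%:R * h \in dvdA 3%N.
  by rewrite -[h](mulKf (_ : 3%:R != 0)) ?pnatr_eq0 // Ez mulKf ?pnatr_eq0.
rewrite h3 -mulrA -f3E mulr_suml rpred_sum // => j _.
rewrite -mulrA [e j * _]mulrC.
have /(@dvdA_dvdn 3 3) := theta_horner f3 j; move=> /(_ isT isT) D3.
have -> : (j : nat)%:R * ((pZ f3).[theta] * e j) =
    (j : nat)%:R * ((pZ f3).[theta] * e j - (f3.[(j : nat)%:Z])%:~R * e j)
    + ((j : nat)%:Z * f3.[(j : nat)%:Z])%:~R * e j.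
  by rewrite rmorphM /=; ring.
rewrite rpredD //; first by apply: dvdA_mull D3 => //; apply: (Aint_int j).
have /dvdzP[k ->] : (3 %| (j : nat)%:Z * f3.[(j : nat)%:Z])%Z.
  by rewrite f3j; case: j {D3} => -[|[|[|[|]]]].
rewrite rmorphM /= mulrAC mulrC; apply: dvdA_mulq => //.
by rewrite rpredM ?Aint_int.
Qed.

Let hQ : Qadj alpha h.
Proof.
have Q1 := Qadj_int alpha 1; have Q2 := Qadj_int alpha 2.
by apply: (@Qadj_divz alpha _ 3); apply: QadjM; [apply: QadjM => // |]; apply: QadjB.
Qed.

(** The scalar is j (j - 1) (j - 2) / 3, that is 0, 0, 0, 2. Dividing by 3 lowers the modulus from 9
    to 3. *)
Let h_e (j : 'I_4) : h * e j - (if j == 3 :> nat then 2 else 0)%:~R * e j \in dvdA 3%N.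
Proof.
set k : int := if _ then _ else _.
have Ek : (j : nat)%:Z * f3.[(j : nat)%:Z] = 3 * k.
  by rewrite f3j /k; case: j @k => -[|[|[|[|]]]].
have Dh : 3%:R * (h * e j - k%:~R * e j) \in dvdA 9%N.
  have -> : 3%:R * (h * e j - k%:~R * e j) =
     (pZ ('X * f3)).[theta] * e j - (('X * f3).[(j : nat)%:Z])%:~R * e j.
    rewrite hornerM hornerX Ek rmorphM /= map_polyX hornerM hornerX f3E.
    by rewrite mulrA -h3 rmorphM /= mulrBr !mulrA.
  exact: theta_horner.
case/dvdAP: Dh => // z Az Ez; apply/dvdAP => //; exists z => //.
apply: (@mulfI _ 3%:R); first by rewrite pnatr_eq0.
by rewrite Ez mulrA -natrM.
Qed.

Let b (i : 'I_4) := [:: 1; theta; theta * (theta - 1); h]`_i.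
(** The scalar by which the combination of the [b i] with coefficients [c] acts on the idempotent of
    index [j], modulo 3. *)
Let val (c : 'I_4 -> int) (j : nat) : int :=
  c 0 + c 1 * j%:Z + c 2%:R * (j%:Z * (j%:Z - 1)) + c 3%:R * (if j == 3 then 2 else 0).

Let sum_b (c : 'I_4 -> int) : \sum_i (c i)%:~R * b i =
  (c 0)%:~R + (c 1)%:~R * theta + (c 2%:R)%:~R * (theta * (theta - 1)) + (c 3%:R)%:~R * h.
Proof.
rewrite !big_ord_recl big_ord0 addr0 /b /= mulr1 !addrA.
by do ![congr (_ + _)]; congr ((c _)%:~R * _); apply/val_inj.
Qed.

Let bA i : b i \in Aint.
Proof.
rewrite /b; case: i => -[|[|[|[|]]]] //= _.
by rewrite rpredM // rpredB.
Qed.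

Let sum_b_e (c : 'I_4 -> int) (j : 'I_4) :
  (\sum_i (c i)%:~R * b i) * e j - (val c j)%:~R * e j \in dvdA 3%N.
Proof.
have /(@dvdA_dvdn 3 3) := theta_horner 'X j; move=> /(_ isT isT) D1.
have /(@dvdA_dvdn 3 3) := theta_horner ('X * ('X - 1%:P)) j; move=> /(_ isT isT) D2.
have D3 := h_e j; move: D1 D2 D3.
rewrite rmorphM rmorphB /= !map_polyC !map_polyX.
rewrite !(hornerM, hornerD, hornerN, hornerX, hornerC) /=.
set k := if _ then _ else _ => D1 D2 D3.
rewrite sum_b /val -/k.
set X := (X in X \in _).
have -> : X = (c 1)%:~R * (theta * e j - (j : nat)%:Z%:~R * e j)
  + (c 2%:R)%:~R * (theta * (theta - 1) * e j
         - ((j : nat)%:Z * ((j : nat)%:Z - 1))%:~R * e j)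
  + (c 3%:R)%:~R * (h * e j - k%:~R * e j).
  by rewrite /X !rmorphD !rmorphM /= !rmorphB /=; ring.
by rewrite !rpredD //; apply: dvdA_mull => //; apply: Aint_int.
Qed.

(** The four residues depend on the coefficients through a triangular matrix with diagonal 1, 1, 2,
    2, which is invertible modulo 3. *)
Let sum_b_dvd3 (c : 'I_4 -> int) : \sum_i (c i)%:~R * b i \in dvdA 3%N -> forall i, (3 %| c i)%Z.
Proof.
move=> D3; have v3 (k : nat) (lt_k : (k < 4)%N) : (3 %| val c k)%Z.
  pose j := Ordinal lt_k; apply: dvdA3_int (eA j) (e_n3 j) _.
  rewrite -[X in X \in _](subKr ((\sum_i (c i)%:~R * b i) * e j)) rpredB ?sum_b_e //.
  by rewrite mulrC; apply: dvdA_mull.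
move: (v3 0%N isT) (v3 1%N isT) (v3 2%N isT) (v3 3%N isT); rewrite /val /=.
move=> /dvdzP[k0 E0] /dvdzP[k1 E1] /dvdzP[k2 E2] /dvdzP[k3 E3].
have d0 : (3 %| c 0%R)%Z by apply/dvdzP; exists k0; lia.
have d1 : (3 %| c 1%R)%Z by apply/dvdzP; exists (k1 - k0); lia.
have d2 : (3 %| c (2%:R)%R)%Z.
  by apply/dvdzP; exists (2 * (k2 - k0 - 2 * (k1 - k0)) - c 2%:R); lia.
have d3 : (3 %| c (3%:R)%R)%Z.
  by apply/dvdzP; exists (2 * (k3 - k0 - c 1 - 2 * c 2%:R) - c 3%:R); lia.
move=> i; case: i => -[|[|[|[|]]]] // lt_i.
- by have -> : Ordinal lt_i = 0 by apply/val_inj.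
- by have -> : Ordinal lt_i = 1 by apply/val_inj.
- by have -> : Ordinal lt_i = 2%:R by apply/val_inj.
- by have -> : Ordinal lt_i = 3%:R by apply/val_inj.
Qed.

Let sum_b_div3 (c : 'I_4 -> int) (D : int) x : x \in Aint ->
    (3 * D)%:~R * x = \sum_i (c i)%:~R * b i ->
  exists2 c' : 'I_4 -> int, forall i, c i = 3 * c' i & D%:~R * x = \sum_i (c' i)%:~R * b i.
Proof.
move=> Ax Ex; have c3 : forall i, (3 %| c i)%Z.
  apply: sum_b_dvd3; rewrite -Ex rmorphM -mulrA; apply: dvdA_mulq => //.
  by rewrite rpredM ?Aint_int.
have cE i : c i = 3 * (c i %/ 3)%Z by rewrite mulrC divzK.
exists (fun i => (c i %/ 3)%Z) => //.
apply: (@mulfI _ 3%:R); first by rewrite pnatr_eq0.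
rewrite mulr_sumr mulrA -[3%:R]/(3%:~R) -intrM Ex; apply: eq_bigr => i _.
by rewrite {1}cE rmorphM mulrA.
Qed.

(** Descent at 3: the coefficients of a relation are divisible by 3, and dividing them by 3 gives
    another relation. They are thus divisible by every power of 3. *)
Let free_b (c : 'I_4 -> int) : \sum_i (c i)%:~R * b i = 0 -> forall i, c i = 0.
Proof.
have dv k : forall c : 'I_4 -> int, \sum_i (c i)%:~R * b i = 0 -> forall i, ((3 ^ k)%N%:Z %| c i)%Z.
  elim: k => [|k IHk] {}c Ec i; first by rewrite expn0 dvd1z.
  have [|c' cE Ec'] := @sum_b_div3 c 1 0 (rpred0 _); first by rewrite mulr0 Ec.
  rewrite mulr0 in Ec'; have /IHk/(_ i)/dvdzP[m Em] := esym Ec'.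
  by apply/dvdzP; exists m; rewrite cE Em expnS PoszM; ring.
move=> /dv{}dv i; apply/eqP; rewrite -absz_eq0; apply/negPn/negP => nz.
have := dv `|c i|%N i; rewrite dvdzE => /dvdn_leq; rewrite lt0n => /(_ nz).
by rewrite absz_nat leqNgt ltn_expl.
Qed.

Let bQ i : Qadj theta (b i).
Proof.
have Q1 := Qadj_int theta 1; have Q2 := Qadj_int theta 2; have Qt := Qadj_self theta.
rewrite /b; case: i => -[|[|[|[|]]]] //= _; first by apply: QadjM => //; apply: QadjB.
by apply: (@Qadj_divz theta _ 3); apply: QadjM; [apply: QadjM => // |]; apply: QadjB.
Qed.

Let span_b x : Qadj alpha x -> exists2 D : int, D != 0 &
    exists c : 'I_4 -> int, D%:~R * x = \sum_i (c i)%:~R * b i.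
Proof.
move=> Qx; apply: (independent_span Dp sp _ free_b Qx) => i.
exact: Qadj_trans thetaQ (bQ i).
Qed.

(** A denominator exists by [span_b]; as [x] is integral, [sum_b_div3] cancels the factors 3 of this
    denominator one at a time. *)
Let local_basis x : OK alpha x -> exists2 m : int, ~~ (3 %| m)%Z &
    exists c : 'I_4 -> int, m%:~R * x = \sum_i (c i)%:~R * b i.
Proof.
move=> [Qx Ax]; have [D nzD [c Ec]] := span_b Qx.
have [k] := ubnP `|D|%N; elim: k => // k IHk in D c nzD Ec *; rewrite ltnS => leD.
have [/dvdzP[D' ED]|nD] := boolP (3 %| D)%Z; last by exists D => //; exists c.
rewrite ED [D' * 3]mulrC in Ec; have [c' _ Ec'] := sum_b_div3 Ax Ec.
apply: IHk Ec' _; lia.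
Qed.

Lemma split3_generator : Defs.generator alpha theta.
Proof.
split=> // x; split; last exact: Qadj_trans.
move=> /span_b[D nzD [c Ec]].
have : Qadj theta (D%:~R * x).
  by rewrite Ec; apply: Qadj_sum => i _; apply: QadjM => //; apply: Qadj_int.
by move/(Qadj_divz D); rewrite mulrAC mulfV ?mul1r // intr_eq0.
Qed.

(** Three of the basis elements lie in Z[theta], so up to factors prime to 3 each class is a
    multiple of that of [h], and 3 h is in Z[theta]. *)
Lemma split3_index_le : exists2 n, (logn 3 n <= 1)%N & (0 < n)%N /\ has_index alpha theta n.
Proof.
have gen := split3_generator.
have [gT [G [g [gOK gM g_inj g_sur]]]] := finite_quotient thetaA.
have gOK' x : x \in G -> OK alpha (g x) 
  by move=> /gOK/(generator_OK _ gen).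
have g_sur' x : OK alpha x -> exists2 y, y \in G & Zadj theta (x - g y).
  by move=> /(generator_OK _ gen)/g_sur.
exists #|G|; last first.
  by split; [apply: cardG_gt0 | apply: (quotient_has_index gOK' g_inj g_sur')].
apply: (quotient_logn3 gOK' gM g_inj g_sur' (h := h)) => //.
- have Z2 := Zadj_int theta 2; have Z1 := Zadj1 theta; have Zt := Zadj_self theta.
  by rewrite h3; apply: ZadjM; [apply: ZadjM => // |]; apply: ZadjB.
move=> x /local_basis[m m3 [c Ec]]; exists m, (c 3%:R); split=> //.
rewrite Ec sum_b addrK; have Zt := Zadj_self theta.
have Zi := Zadj_int theta.
apply: ZadjD; first by apply: ZadjD => //; apply: ZadjM.
by do 2!apply: ZadjM => //; apply: ZadjB => //; apply: Zadj1.
Qed.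

(* The four residue homomorphisms of [O_K] at the primes above 3. *)
Let residue x : OK alpha x -> forall j, exists tau : int, x * e j - tau%:~R * e j \in dvdA 3%N.
Proof.
move=> OKx j; have [_ Ax] := OKx; have [m m3 [c Ec]] := local_basis OKx.
have /coprimezP[[u v] /= Euv] : coprimez 3 m by rewrite coprimezE prime_coprime.
exists (v * val c j); have := sum_b_e c j; rewrite -Ec => De.
have E1 : u%:~R * 3%:R + v%:~R * m%:~R = 1 :> algC.
  by have := congr1 (intr : int -> algC) Euv; rewrite rmorphD !rmorphM.
have -> : x * e j - (v * val c j)%:~R * e j =
   3%:R * (u%:~R * (x * e j)) + v%:~R * (m%:~R * x * e j - (val c j)%:~R * e j).
  rewrite rmorphM /=; transitivity ((u%:~R * 3%:R + v%:~R * m%:~R) * (x * e j)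
    - v%:~R * (val c j)%:~R * e j); [by rewrite E1 mul1r | ring].
rewrite rpredD //; last by apply: dvdA_mull => //; apply: Aint_int.
by apply: dvdA_mulq => //; rewrite !rpredM ?Aint_int.
Qed.

(* Two of the four residues of [t] in [F_3] coincide, so [Z[t]] does not separate
   the four primes above 3. *)
Lemma split3_index t n : OK alpha t -> has_index alpha t n -> (3 %| n)%N.
Proof.
move=> OKt ind; have [Qt At] := OKt.
have [tau tauP] := fin_all_exists (residue OKt).
have [i [j [neq_ij eq_ij]]] :
    exists i j, i != j /\ (tau i == tau j %[mod 3])%Z.
  pose r (i : 'I_4) : 'I_3 := inord `|(tau i %% 3)%Z|%N.
  have /injectivePn[i [j neq_ij eq_r]] : ~~ injectiveb r.
    by apply/injectiveP => /leq_card; rewrite !card_ord.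
  exists i, j; split=> //; move/(congr1 (@nat_of_ord 3)): eq_r.
  have ge0 k : (0 <= (tau k %% 3)%Z)%R by apply: modz_ge0.
  have lt3 k : ((tau k %% 3)%Z < 3)%R by apply: ltz_pmod.
  rewrite !inordK; last 2 first.
  - by have := ge0 j; have := lt3 j; lia.
  - by have := ge0 i; have := lt3 i; lia.
  by have := ge0 i; have := ge0 j; lia.
(* Write n e_i = f(t) with [f] integral. Multiplying by [e i] gives f(tau_i) = n modulo 3,
   multiplying by [e j] gives f(tau_j) = 0, while tau_i = tau_j modulo 3. *)
have [f Ef] := index_mul ind (eOK i).
have Di := @eigen_horner 3 t (e i) (tau i) f isT At (eA i) (tauP i).
have Dj := @eigen_horner 3 t (e j) (tau j) f isT At (eA j) (tauP j).
rewrite -Ef in Di Dj.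
have dj : (3 %| f.[tau j])%Z.
  apply: dvdA3_int (eA j) (e_n3 j) _.
  have : n%:R * (e i * e j) \in dvdA 3%N.
    apply: dvdA_mull => //; first exact: (Aint_int n).
    by apply: (@dvdA_dvdn 3 3) => //; apply: e_orth.
  rewrite mulrA => Dn.
  by rewrite -[X in X \in _](subKr (n%:R * e i * e j)); apply: rpredB.
have di : (3 %| n%:Z - f.[tau i])%Z.
  apply: dvdA3_int (eA i) (e_n3 i) _.
  have : n%:R * (e i * e i - e i) \in dvdA 3%N.
    apply: dvdA_mull => //; first exact: (Aint_int n).
    exact: (@dvdA_dvdn 3 3).
  move=> Dn; have -> : (n%:Z - f.[tau i])%:~R * e i =
      (n%:R * e i * e i - (f.[tau i])%:~R * e i) - n%:R * (e i * e i - e i).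
    by rewrite rmorphB /=; ring.
  exact: rpredB.
have dij : (3 %| f.[tau i] - f.[tau j])%Z.
  by apply: dvdz_horner_sub; rewrite -eqz_mod_dvd.
have : (3 %| n%:Z)%Z.
  have -> : n%:Z = (n%:Z - f.[tau i]) + ((f.[tau i] - f.[tau j]) + f.[tau j]) by ring.
  by apply: rpredD di _; apply: rpredD.
by [].
Qed.

Lemma split3_conclusion : exists g : nat,
  [/\ is_common_index alpha g, (3 %| g)%N, logn 3 g = 1%N & ~ monogenic alpha].
Proof.
have gen := split3_generator.
have [n0 le1 [n0_gt0 ind0]] := split3_index_le.
pose S n := exists2 t, Defs.generator alpha t & has_index alpha t n.
have [||g gS gmax] := @gcd_exists S n0; [by [] | by exists theta |].
have g3 : (3 %| g)%N by apply: gmax => n [t [OKt _] /(split3_index OKt)].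
have dvd_g : (g %| n0)%N by apply: gS; exists theta.
exists g; split=> //.
- split=> [t n gent indt|d dP]; first by apply: gS; exists t.
  by apply: gmax => n [t gent indt]; apply: dP gent indt.
- apply/eqP; rewrite eqn_leq (leq_trans (dvdn_leq_log 3 n0_gt0 dvd_g)) //=.
  by rewrite logn_gt0 mem_primes /= g3 (dvdn_gt0 n0_gt0 dvd_g).
(* A power basis would have index 1, with the single class of 0. *)
move=> [t [OKt mono]]; suffices /(split3_index OKt) : has_index alpha t 1 by [].
exists [:: 0]; split=> //.
- move=> y; rewrite inE => /eqP ->; split=> //; exact: (Qadj_int alpha 0).
- by move=> [|i] [|j].
by move=> x /mono Zx; exists 0; rewrite ?inE // subr0.
Qed.

End SplitAt3.

(** * Idempotents from approximate roots *)

(** The minimal polynomial of the quadratic expression, composed with X^2 - w X, is monic, integral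
    and vanishes at [x]. *)
Lemma Aint_quadratic x (w : int) : x * x - w%:~R * x \in Aint -> x \in Aint.
Proof.
set y := _ - _ => Ay; have /floorpP[P DP] := Ay.
pose q : {poly algC} := 'X^2 - w%:~R%:P * 'X.
have sq : size q = 3.
  rewrite /q size_polyDl size_polyXn // size_polyN.
  rewrite (leq_ltn_trans (size_polyMleq _ _)) // size_polyX addn2 /=.
  by rewrite !ltnS size_polyC leq_b1.
have lq : lead_coef q = 1.
  by rewrite lead_coefE sq /q coefB coefXn coefCM coefX mulr0 subr0.
apply: (@root_monic_Aint (minCpoly y \Po q)).
- have qx : q.[x] = y by rewrite /q !hornerE.
  by rewrite /root horner_comp qx; apply: root_minCpoly.
- by rewrite monicE lead_coef_comp ?sq // lq expr1n mulr1; apply: minCpoly_monic.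
apply: polyOver_comp => //.
by rewrite rpredB ?rpredM ?rpredX ?polyOverX // polyOverC intr_int.
Qed.

(** The sum of the values of a cubic [L] at the roots of the monic quartic [f], with the power sums
    given by Newton's identities. Being polynomial in the coefficients, it is compatible with
    congruences and ring morphisms, even where the roots of congruent quartics cannot be compared
    directly. *)
Definition quartic_trace (R : comNzRingType) (f L : {poly R}) : R :=
  4%:R * L`_0 - L`_1 * f`_3 + L`_2 * (f`_3 ^+ 2 - 2%:R * f`_2)
  + L`_3 * (3%:R * f`_3 * f`_2 - f`_3 ^+ 3 - 3%:R * f`_1).

Lemma quartic_traceE (R : comNzRingType) (x : 'I_4 -> R) (L : {poly R}) :
  (size L <= 4)%N ->
  \sum_i L.[x i] = quartic_trace (\prod_i ('X - (x i)%:P)) L.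
Proof.
move=> sL; rewrite !big_ord_recl !big_ord0 !(horner_coef_wide _ sL).
set x0 := x _; set x1 := x _; set x2 := x _; set x3 := x _.
have -> : ('X - x0%:P) * (('X - x1%:P) * (('X - x2%:P) * (('X - x3%:P) * 1))) =
   'X^4 - (x0 + x1 + x2 + x3)%:P * 'X^3
   + (x0 * x1 + x0 * x2 + x0 * x3 + x1 * x2 + x1 * x3 + x2 * x3)%:P * 'X^2
   - (x0 * x1 * x2 + x0 * x1 * x3 + x0 * x2 * x3 + x1 * x2 * x3)%:P * 'X
   + (x0 * x1 * x2 * x3)%:P.
  by rewrite !(polyCD, polyCM); ring.
rewrite /quartic_trace.
rewrite !(coefD, coefN, coefCM, coefC, coefXn, coefX) /= !big_ord_recl !big_ord0 /bump /=.
by ring.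
Qed.

Lemma quartic_trace_cong (f g h L : {poly int}) (q : int) : f = g + q *: h ->
  (q %| quartic_trace f L - quartic_trace g L)%Z.
Proof.
move=> ->; rewrite /quartic_trace !coefD !coefZ; apply/dvdzP.
exists (- L`_1 * h`_3 + L`_2 * (2%:R * g`_3 * h`_3 + q * h`_3 ^+ 2 - 2%:R * h`_2)
  + L`_3 * (3%:R * (g`_3 * h`_2 + h`_3 * g`_2 + q * h`_3 * h`_2)
    - (3%:R * g`_3 ^+ 2 * h`_3 + 3%:R * q * g`_3 * h`_3 ^+ 2 + q ^+ 2 * h`_3 ^+ 3)
    - 3%:R * h`_1)).
by ring.
Qed.

Lemma quartic_trace_map (R S : comNzRingType) (phi : {rmorphism R -> S}) (f L : {poly R}) :
  quartic_trace (map_poly phi f) (map_poly phi L) = phi (quartic_trace f L).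
Proof.
rewrite /quartic_trace !coef_map !(rmorph_nat, rmorphXn, rmorphD, rmorphB, rmorphM).
by rewrite ?rmorph1; ring.
Qed.

(** The trace of the integral element L(alpha) / m, summed over the conjugates, is an integer since
    it is integral and rational. *)
Lemma quartic_trace_Aint alpha (F L : {poly int}) (m : int) :
    size F = 5 -> minCpoly alpha = pZ F -> (size L <= 4)%N -> m != 0 ->
    (pZ L).[alpha] / m%:~R \in Aint ->
  (m %| quartic_trace F L)%Z.
Proof.
move=> sF DF sL nzm Ay; have nzmC : m%:~R != 0 :> algC by rewrite intr_eq0.
have [rs Drs] := closed_field_poly_normal (minCpoly alpha).
rewrite (monicP (minCpoly_monic alpha)) scale1r in Drs.
have srs : size rs = 4.
  apply/eq_add_S; rewrite -(size_prod_XsubC rs id) -Drs DF.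
  by rewrite size_map_inj_poly //; apply: intr_inj.
have sLC : (size (pZ L) <= 4)%N by apply: leq_trans (size_poly _ _) _.
pose g : {poly rat} := m%:~R^-1 *: map_poly intr L.
have gE b : (pQ g).[b] = (pZ L).[b] / m%:~R.
  by rewrite /g map_polyZ hornerZ pQ_intr fmorphV rmorph_int mulrC.
have : (\sum_(i < 4) (pZ L).[rs`_i]) / m%:~R \in Aint.
  rewrite mulr_suml rpred_sum // => i _; rewrite -gE.
  apply: (@conjugate_Aint alpha); last by rewrite gE.
  by rewrite Drs root_prod_XsubC mem_nth // srs.
rewrite (quartic_traceE (fun i : 'I_4 => rs`_i) sLC).
have -> : \prod_(i < 4) ('X - (rs`_i)%:P) = pZ F.
  by rewrite -DF Drs [RHS](big_nth 0) srs big_mkord.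
rewrite quartic_trace_map => AT.
have : ((quartic_trace F L)%:~R / m%:~R : algC) \is a Num.int.
  apply: Cint_rat_Aint AT.
  by rewrite rpred_div ?rpred_int.
move=> /intrP[k Ek]; apply/dvdzP; exists k; apply: (@intr_inj algC).
by rewrite rmorphM /= -Ek divfK.
Qed.

Section ApproximateRoots.

Variables (alpha : algC) (F R : {poly int}) (r : 'I_4 -> int) (N : nat).
Hypotheses (sF : size F = 5) (DF : minCpoly alpha = pZ F).

Let L i : {poly int} := \prod_(j | j != i) ('X - (r j)%:P).
Let u i : int := \prod_(j | j != i) (r i - r j).
Let k i := nu 3 (u i).

Hypotheses (FE : F = \prod_i ('X - (r i)%:P) + (3 ^ N)%N%:Z *: R)
  (u_neq0 : forall i, u i != 0) (le_kN : forall i, (2 * k i + 2 <= N)%N).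

Let Aalpha : alpha \in Aint.
Proof.
rewrite unfold_in DF; apply/polyOverP => i.
by rewrite coef_map /= intr_int.
Qed.

Let G := \prod_i ('X - (r i)%:P).

Let Galpha : (pZ G).[alpha] = - (3 ^ N)%N%:R * (pZ R).[alpha].
Proof.
have : (pZ F).[alpha] = 0 by rewrite -DF; apply/eqP/(root_minCpoly alpha).
rewrite FE rmorphD /= map_polyZ hornerD hornerZ /= => /eqP.
by rewrite addr_eq0 mulNr => /eqP.
Qed.

Let GL i : G = L i * ('X - (r i)%:P).
Proof. by rewrite /G (bigD1 i) //= mulrC. Qed.

Let Lr i : (L i).[r i] = u i.
Proof.
rewrite horner_prod; apply: eq_bigr => j _.
by rewrite hornerD hornerN hornerX hornerC.
Qed.

Let Lr0 i j : j != i -> (L i).[r j] = 0.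
Proof.
move=> neq_ji; rewrite horner_prod (bigD1 j) //=.
by rewrite hornerD hornerN hornerX hornerC subrr mul0r.
Qed.

Let sL i : (size (L i) <= 4)%N.
Proof.
have monL : L i \is monic by apply: monic_prod_XsubC.
have : size G = 5 by rewrite size_prod_XsubC /index_enum -enumT size_enum_ord.
by rewrite (GL i) size_monicM ?monic_neq0 ?monicXsubC // size_XsubC addn2 => -[->].
Qed.

Let w i := ppart 3 (u i).
Let uE i : u i = (3 ^ k i)%N%:Z * w i.
Proof.
rewrite /w /ppart mulrC divzK // dvdzE absz_nat.
by rewrite /k /nu pfactor_dvdnn.
Qed.

Let w_n3 i : ~~ (3 %| w i)%Z.
Proof.
apply/negP => /dvdzP[m Em].
have : ((3 ^ (k i).+1)%N %| `|u i|)%N.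
  by rewrite uE Em abszM absz_nat expnSr abszM mulnA dvdn_mul ?dvdn_mulr.
by rewrite pfactor_dvdn ?lt0n ?absz_eq0 // ltnn.
Qed.

(** An inverse modulo 9, used to rescale [f i], on which [f i] itself acts as [w i], into an
    idempotent modulo 9. *)
Let w'P i : exists w', (w' * w i == 1 %[mod 9])%Z.
Proof.
have co3 : coprime `|w i|%N 3.
  by rewrite coprime_sym prime_coprime //; have := w_n3 i; rewrite dvdzE.
have : coprimez (w i) 9 by have := coprimeXr 2 co3; rewrite coprimezE.
case/coprimezP => -[a b] /= Eab; exists a.
by rewrite eqz_mod_dvd; apply/dvdzP; exists (- b); lia.
Qed.

Let f i := (pZ (L i)).[alpha] / (3 ^ k i)%N%:R.

Let nz3 m : (3 ^ m)%N%:R != 0 :> algC.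
Proof. by rewrite pnatr_eq0 expn_eq0. Qed.

(** The polynomial L_i (L_i - u_i) is a multiple of G = L_i (X - r_i), since L_i - u_i vanishes at
    r_i; and G(alpha) is divisible by 3^N. Dividing by 3^(2 k_i) still leaves a factor 9. *)
Let f_quad i : exists2 s, s \in Aint & f i * f i - (w i)%:~R * f i = 9%:R * s.
Proof.
have /factor_theorem[Q DQ] : root (L i - (u i)%:P) (r i).
  by rewrite /root hornerD hornerN hornerC Lr subrr.
exists (- (3 ^ (N - (2 * k i + 2)))%N%:R * ((pZ R).[alpha] * (pZ Q).[alpha])).
  rewrite mulNr rpredN rpredM ?(Aint_int (3 ^ _)%N) // rpredM //.
    by apply: (Zadj_Aint Aalpha); exists R.
  by apply: (Zadj_Aint Aalpha); exists Q.
have EL : (pZ (L i)).[alpha] * ((pZ (L i)).[alpha] - (u i)%:~R)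
    = - (3 ^ N)%N%:R * (pZ R).[alpha] * (pZ Q).[alpha].
  have := congr1 (fun h => (pZ h).[alpha]) DQ.
  rewrite rmorphB /= map_polyC hornerD hornerN hornerC => ->.
  rewrite rmorphM hornerM mulrCA -hornerM -rmorphM -GL Galpha; ring.
have E3 : (3 ^ N)%N%:R =
    9%:R * (3 ^ (N - (2 * k i + 2)))%N%:R * ((3 ^ k i)%N%:R * (3 ^ k i)%N%:R) :> algC.
  rewrite -!natrM -(_ : (3 ^ 2 = 9)%N) // -!expnD; congr (_ ^ _)%N%:R.
  by have := le_kN i; lia.
have -> : f i * f i - (w i)%:~R * f i =
    (pZ (L i)).[alpha] * ((pZ (L i)).[alpha] - (u i)%:~R) / ((3 ^ k i)%N%:R * (3 ^ k i)%N%:R).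
  have := nz3 (k i); rewrite uE rmorphM /= -[(3 ^ k i)%N%:~R]/((3 ^ k i)%N%:R) /f.
  by move: (3 ^ k i)%N%:R => c nzc; field.
rewrite EL E3; have := nz3 (k i); move: (3 ^ k i)%N%:R => c nzc; field.
exact: nzc.
Qed.

Let fA i : f i \in Aint.
Proof.
have [s As Es] := f_quad i; apply: (@Aint_quadratic _ (w i)).
by rewrite Es rpredM // (Aint_int 9).
Qed.

Let fQ i : Qadj alpha (f i).
Proof. by apply: (@Qadj_divz alpha _ (3 ^ k i)%N); apply: Zadj_Qadj; exists (L i). Qed.

(** Here L_i L_j is already a multiple of [G], with cofactor the product [H] of the two remaining
    linear factors. *)
Let f_orth i j : i != j -> f i * f j \in dvdA 9%N.
Proof.
move=> neq_ij; apply/dvdAP => //.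
pose H : {poly int} := \prod_(l | (l != i) && (l != j)) ('X - (r l)%:P).
have LE : L i = ('X - (r j)%:P) * H by rewrite /L (bigD1 j) // eq_sym.
exists (- (3 ^ (N - (k i + k j + 2)))%N%:R * ((pZ R).[alpha] * (pZ H).[alpha])).
  rewrite mulNr rpredN rpredM ?(Aint_int (3 ^ _)%N) // rpredM //.
    by apply: (Zadj_Aint Aalpha); exists R.
  by apply: (Zadj_Aint Aalpha); exists H.
have EL : (pZ (L i)).[alpha] * (pZ (L j)).[alpha]
    = - (3 ^ N)%N%:R * (pZ R).[alpha] * (pZ H).[alpha].
  rewrite LE rmorphM hornerM mulrAC mulrC -mulrA [_ * (pZ (L j)).[_]]mulrC.
  by rewrite -hornerM -rmorphM -GL Galpha; ring.
have E3 : (3 ^ N)%N%:R =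
    9%:R * (3 ^ (N - (k i + k j + 2)))%N%:R * ((3 ^ k i)%N%:R * (3 ^ k j)%N%:R) :> algC.
  rewrite -!natrM -(_ : (3 ^ 2 = 9)%N) // -!expnD; congr (_ ^ _)%N%:R.
  by have := le_kN i; have := le_kN j; lia.
have -> : f i * f j =
    (pZ (L i)).[alpha] * (pZ (L j)).[alpha] / ((3 ^ k i)%N%:R * (3 ^ k j)%N%:R).
  by rewrite invfM mulrACA.
rewrite EL E3; have := nz3 (k i); have := nz3 (k j).
move: (3 ^ k i)%N%:R (3 ^ k j)%N%:R => c d nzc nzd; field.
by rewrite nzc nzd.
Qed.

(** The trace of L_i(alpha) is congruent modulo 3^N to the sum of the L_i(r_j), which reduces to
    u_i, of valuation exactly k_i. Divisibility of [f i] by 3 would make the valuation of this trace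
    at least k_i + 1. *)
Let f_n3 i : f i \notin dvdA 3%N.
Proof.
apply/negP => /dvdAP[//|z Az Ez].
have d1 : ((3 ^ (k i).+1)%N %| quartic_trace F (L i))%Z.
  apply: (quartic_trace_Aint sF DF) => //; first by rewrite -lt0n expn_gt0.
  suffices -> : (pZ (L i)).[alpha] / (3 ^ (k i).+1)%N%:~R = z by [].
  rewrite -[(pZ _).[_]](divfK (nz3 (k i))) -/(f i) Ez -[(3 ^ (k i).+1)%N%:~R]/((3 ^ (k i).+1)%N%:R).
  rewrite expnS natrM; have := nz3 (k i).
  by move: (3 ^ k i)%N%:R => c nzc; field.
have d2 := quartic_trace_cong (L i) FE.
have tG : quartic_trace (\prod_i ('X - (r i)%:P)) (L i) = u i.
  rewrite -quartic_traceE // (bigD1 i) //= Lr big1 ?addr0 // => j neq_ji.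
  exact: Lr0.
have d3 : ((3 ^ (k i).+1)%N %| (3 ^ N)%N%:Z)%Z.
  by rewrite dvdzE !absz_nat dvdn_exp2l //; have := le_kN i; lia.
have : ((3 ^ (k i).+1)%N %| u i)%Z.
  rewrite -tG -[quartic_trace (\prod__ _) _](subKr (quartic_trace F (L i))).
  by rewrite rpredB // (dvdz_trans d3).
by rewrite dvdzE absz_nat pfactor_dvdn ?lt0n ?absz_eq0 // ltnn.
Qed.

Lemma approximate_roots_conclusion : exists g : nat,
  [/\ is_common_index alpha g, (3 %| g)%N, logn 3 g = 1%N & ~ monogenic alpha].
Proof.
have [w' w'E] := fin_all_exists w'P.
have zP i : exists z : int, w' i * w i = 1 + z * 9.
  have := w'E i; rewrite eqz_mod_dvd => /dvdzP[y Ey]; exists y; lia.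
have [z zE] := fin_all_exists zP.
have zEC i : (w' i)%:~R * (w i)%:~R = 1 + (z i)%:~R * 9%:R :> algC.
  by rewrite -rmorphM /= zE rmorphD rmorphM.
apply: (@split3_conclusion alpha (map_poly intr F) (fun i => (w' i)%:~R * f i)).
- by rewrite pQ_intr.
- by rewrite size_map_inj_poly // ; apply: intr_inj.
- move=> i; split; last by rewrite rpredM // Aint_int.
  by apply: QadjM => //; apply: Qadj_int.
- move=> i j /f_orth Dij; rewrite mulrACA; apply: dvdA_mull Dij => //.
  by rewrite rpredM ?Aint_int.
- move=> i; have [s As Es] := f_quad i; apply/dvdAP => //.
  exists ((w' i)%:~R ^+ 2 * s + (z i)%:~R * (w' i)%:~R * f i).
    by apply: rpredD; repeat apply: rpredM => //; rewrite ?rpredX ?Aint_int.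
  transitivity ((w' i)%:~R ^+ 2 * (f i * f i - (w i)%:~R * f i)
     + (w' i)%:~R * ((w' i)%:~R * (w i)%:~R - 1) * f i); first by ring.
  by rewrite Es zEC; ring.
move=> i; apply: contra (f_n3 i) => D3.
have -> : f i = (w i)%:~R * ((w' i)%:~R * f i) - 3%:R * (3%:R * (z i)%:~R * f i).
  transitivity (((w' i)%:~R * (w i)%:~R - (z i)%:~R * 9%:R) * f i); last by ring.
  by rewrite zEC addrK mul1r.
rewrite rpredB //; first by apply: dvdA_mull D3 => //; apply: Aint_int.
apply: dvdA_mulq => //; apply: rpredM => //.
by apply: rpredM; [apply: rpred_nat | apply: Aint_int].
Qed.

End ApproximateRoots.

(** * Three-adic approximate roots *)

Lemma Posz_exp (m n : nat) : (m ^ n)%N%:Z = m%:Z ^+ n.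
Proof. by elim: n => // n IHn; rewrite expnS exprS PoszM IHn. Qed.

Lemma dvd3X_nu n (m : int) : m != 0 -> (3 ^+ n %| m)%Z = (n <= nu 3 m)%N.
Proof. by move=> nzm; rewrite -(Posz_exp 3) dvdzE absz_nat pfactor_dvdn // lt0n absz_eq0. Qed.

Lemma ppartE (m : int) : m = 3 ^+ nu 3 m * ppart 3 m.
Proof.
rewrite /ppart -(Posz_exp 3) mulrC divzK // dvdzE absz_nat.
by rewrite /nu pfactor_dvdnn.
Qed.

Lemma dvd3X_cancel A K (x d : int) : ~~ (3 ^+ K.+1 %| d)%Z ->
  (3 ^+ (A + K) %| x * d)%Z -> (3 ^+ A %| x)%Z.
Proof.
move=> nd; have nzd : d != 0 by apply: contraNneq nd => ->; apply: dvdz0.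
have [-> _|nzx] := eqVneq x 0; first exact: dvdz0.
rewrite dvd3X_nu // -ltnNge ltnS in nd.
rewrite !dvd3X_nu ?mulf_neq0 // /nu abszM lognM ?lt0n ?absz_eq0 // => le_xd.
by move: nd; rewrite /nu; lia.
Qed.

Lemma logn_prod (p : nat) (I : finType) (P : pred I) (f : I -> nat) :
  (forall i, P i -> (0 < f i)%N) ->
  logn p (\prod_(i | P i) f i) = (\sum_(i | P i) logn p (f i))%N.
Proof.
move=> f_gt0; apply/esym.
suffices [] : (0 < \prod_(i | P i) f i)%N /\
  (\sum_(i | P i) logn p (f i))%N = logn p (\prod_(i | P i) f i) by [].
elim/big_rec2: _ => [|i m n Pi [m_gt0 ->]]; first by rewrite logn1.
by rewrite muln_gt0 f_gt0 // lognM ?f_gt0.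
Qed.

(** Valuation of the difference at most [K]; stated through divisibility, it also excludes
    equality. *)
Definition separated3 K : rel int := fun x y => ~~ (3 ^+ K.+1 %| x - y)%Z.

(** Division by X - x leaves the remainder P(x), which is negligible. At another approximate root y,
    the quotient satisfies Q(y) (x - y) = P(x) - P(y), and cancelling x - y costs at most [K] powers
    of 3: hence the reserve of [K] for each root. *)
Lemma approximate_factorization K N (s : seq int) (P : {poly int}) :
    P \is monic -> size P = (size s).+1 -> pairwise (separated3 K) s ->
    (forall x, x \in s -> (3 ^+ (N + K * size s) %| P.[x])%Z) ->
  exists R : {poly int}, P = \prod_(x <- s) ('X - x%:P) + 3 ^+ N *: R.
Proof.
elim: s P => [|x s IHs] P monP sP /=.
  move=> _ _; exists 0; rewrite big_nil scaler0 addr0.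
  by have /size_poly1P[c _ Dc] := introT eqP sP; move: monP;
     rewrite Dc monicE lead_coefC => /eqP ->.
case/andP => /allP sepx seps rootP.
have /factor_theorem[Q DQ] : root (P - (P.[x])%:P) x.
  by rewrite /root hornerD hornerN hornerC subrr.
have DP : P = Q * ('X - x%:P) + (P.[x])%:P by rewrite -DQ subrK.
have sPx : (size ((P.[x])%:P) < size P)%N.
  by rewrite sP (leq_ltn_trans (size_polyC_leq1 _)).
have sE : size (Q * ('X - x%:P)) = size P.
  by rewrite -DQ size_polyDl // size_polyN.
have lE : lead_coef (Q * ('X - x%:P)) = 1.
  by rewrite -DQ lead_coefDl ?size_polyN //; apply/monicP.
have monQ : Q \is monic by move: lE; rewrite lead_coef_Mmonic ?monicXsubC // => /eqP.
have sQ : size Q = (size s).+1.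
  move: sE; rewrite sP size_monicM ?monic_neq0 ?monicXsubC // size_XsubC addn2.
  by case.
have Px : (3 ^+ (N + K * (size s).+1) %| P.[x])%Z by apply: rootP; rewrite inE eqxx.
have [|R DR] := IHs Q monQ sQ seps.
  move=> y ys; have Py := rootP y (mem_behead (ys : y \in behead (x :: s))).
  apply: (@dvd3X_cancel _ K _ (x - y)); first exact: sepx.
  rewrite -addnA -mulnSr /= in Py *.
  have -> : Q.[y] * (x - y) = P.[x] - P.[y].
    by rewrite {2}DP hornerD hornerM hornerD hornerN hornerX !hornerC; ring.
  exact: rpredB.
have /dvdzP[m Em] : (3 ^+ N %| P.[x])%Z.
  by apply: dvdz_trans Px; rewrite exprD dvdz_mulr.
exists (R * ('X - x%:P) + m%:P); rewrite big_cons {1}DP DR Em.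
rewrite scalerDr mulrDl -!mul_polyC polyCM; ring.
Qed.

(** [K] is fixed before [N], so the precision can be chosen large compared with the distances
    between the roots. *)
Lemma local_roots_conclusion alpha (F : {poly int}) K :
    size F = 5 -> minCpoly alpha = pZ F ->
    (forall N, exists s : seq int, [/\ size s = 4, pairwise (separated3 K) s
       & forall x, x \in s -> (3 ^+ N %| F.[x])%Z]) ->
  exists g : nat,
  [/\ is_common_index alpha g, (3 %| g)%N, logn 3 g = 1%N & ~ monogenic alpha].
Proof.
(* Each u_i is a product of three differences, of valuation at most 3 K; doubling and adding 2 gives
   6 K + 2. The further K * 4 is consumed by the factorization. *)
move=> sF DF /(_ (6 * K + 2 + K * 4)%N)[s [ss seps rootF]].
have monF : F \is monic.
  apply/eqP/(@intr_inj algC); rewrite -(lead_coef_map_inj (@intr_inj algC)) //.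
  by rewrite -DF (monicP (minCpoly_monic alpha)).
have [||R DR] := @approximate_factorization K (6 * K + 2) s F monF _ seps.
- by rewrite ss.
- by rewrite ss.
have sep (i j : 'I_4) : j != i -> (0 < `|(s`_i - s`_j)%R|)%N && (nu 3 (s`_i - s`_j) <= K)%N.
  move=> neq_ji; have : ~~ (3 ^+ K.+1 %| s`_i - s`_j)%Z.
    have /pairwiseP sepP := seps; move: neq_ji; rewrite neq_ltn.
    case/orP => ltij.
      rewrite -rpredN opprB; apply: (sepP 0); rewrite ?inE ?ss //.
    by apply: (sepP 0); rewrite ?inE ?ss.
  have [->|nz] := eqVneq (s`_i - s`_j) 0; first by rewrite dvdz0.
  by rewrite dvd3X_nu // -leqNgt lt0n absz_eq0 nz.
have abs_prod i : `|(\prod_(j < 4 | j != i) (s`_i - s`_j))%R|%N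
    = (\prod_(j < 4 | j != i) `|(s`_i - s`_j)%R|)%N.
  by apply: (big_morph _ abszM).
apply: (@approximate_roots_conclusion alpha F R (fun i => s`_i) (6 * K + 2) sF DF).
- rewrite {1}DR (big_nth 0) ss big_mkord Posz_exp; congr (_ + _).
- move=> i; rewrite -absz_eq0 abs_prod -lt0n prodn_cond_gt0 // => j.
  by case/(sep i)/andP.
move=> i; rewrite /nu abs_prod logn_prod; last by move=> j /(sep i)/andP[].
set S := (\sum_(_ < _ | _) _)%N; suffices : (S <= 3 * K)%N by move: S => S; lia.
have -> : (3 * K = \sum_(j < 4 | j != i) K)%N.
  by rewrite sum_nat_const cardC1 card_ord.
by apply: leq_sum => j /(sep i)/andP[].
Qed.

Lemma hensel3 (H : {poly int}) (y0 : int) : (3 %| H.[y0])%Z -> ~~ (3 %| H^`().[y0])%Z ->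
  forall N, exists2 y, (3 %| y - y0)%Z & (3 ^+ N %| H.[y])%Z.
Proof.
move=> Hy0 H'y0; suffices main N : exists2 y, (3 %| y - y0)%Z & (3 ^+ N.+1 %| H.[y])%Z.
  by move=> N; have [y dy Hy] := main N; exists y => //;
    apply: dvdz_trans Hy; rewrite exprS dvdz_mull.
elim: N => [|N [y dy Hy]]; first by exists y0; rewrite ?subrr ?dvdz0 ?expr1.
(* Dividing twice by X - y gives the Taylor formula H(z) = H(y) + Q(y) (z - y) + Q2(z) (z - y)^2
   over the integers, with Q(y) = H'(y). *)
have /factor_theorem[Q DQ] : root (H - (H.[y])%:P) y.
  by rewrite /root hornerD hornerN hornerC subrr.
have /factor_theorem[Q2 DQ2] : root (Q - (Q.[y])%:P) y.
  by rewrite /root hornerD hornerN hornerC subrr.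
have HE z : H.[z] = Q.[z] * (z - y) + H.[y].
  have := congr1 (horner^~ z) DQ.
  by rewrite hornerM !hornerD !hornerN hornerX !hornerC => <-; rewrite subrK.
have QE z : Q.[z] = Q2.[z] * (z - y) + Q.[y].
  have := congr1 (horner^~ z) DQ2.
  by rewrite hornerM !hornerD !hornerN hornerX !hornerC => <-; rewrite subrK.
have H'y : H^`().[y] = Q.[y].
  have := congr1 (fun P : {poly int} => P^`().[y]) DQ.
  rewrite derivB derivC subr0 derivM derivXsubC mulr1 => ->.
  by rewrite hornerD hornerM hornerD hornerN hornerX hornerC subrr mulr0 add0r.
have nQ : ~~ (3 %| Q.[y])%Z.
  apply: contra H'y0 => dQ; have := dvdz_horner_sub H^`() dy; rewrite H'y => dd.
  by rewrite -[H^`().[y0]](subKr Q.[y]) rpredB.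
(* Newton's correction would divide by Q(y); as Q(y)^2 = 1 modulo 3, multiplying by Q(y) does as
   well. The quadratic remainder carries 3^(2N+2), enough for the next precision. *)
case/dvdzP: Hy => m Em; pose t := - m * Q.[y]; exists (y + 3 ^+ N.+1 * t).
  rewrite addrAC rpredD // exprS -!mulrA dvdz_mulr //.
have [k Ek] : exists k, Q.[y] * Q.[y] = 1 + 3 * k.
  have [e Ee] : exists k, (Q.[y] = 1 + 3 * k) \/ (Q.[y] = - 1 + 3 * k).
    exists ((Q.[y] + 1) %/ 3)%Z; move: nQ; rewrite dvdzE; lia.
  by case: Ee => ->; [exists (3 * e ^+ 2 + 2 * e) | exists (3 * e ^+ 2 - 2 * e)]; ring.
apply/dvdzP; exists (- m * k + 3 ^+ N * t ^+ 2 * Q2.[y + 3 ^+ N.+1 * t]).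
rewrite HE QE Em; set q2 := Q2.[_].
transitivity (3 ^+ N.+1 * (m - m * (Q.[y] * Q.[y])) + 3 ^+ N.+1 * 3 ^+ N.+1 * t ^+ 2 * q2).
  by rewrite /t; ring.
by rewrite Ek !exprS; ring.
Qed.

Lemma scaled_hensel3 (F H : {poly int}) (s d q y0 : int) :
    (forall y, F.[s + d * y] = q * H.[y]) ->
    (3 %| H.[y0])%Z -> ~~ (3 %| H^`().[y0])%Z ->
  forall N, exists2 y, (3 %| y - y0)%Z & (3 ^+ N %| F.[s + d * y])%Z.
Proof.
move=> FH Hy0 H'y0 N; have [y dy Hy] := hensel3 Hy0 H'y0 N.
by exists y; rewrite ?FH ?dvdz_mull.
Qed.

(** * Explicit quartics and the shapes of their Newton polygons at 3 *)

Definition poly4 (a4 a3 a2 a1 a0 : int) : {poly int} :=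
  a4%:P * 'X^4 + a3%:P * 'X^3 + a2%:P * 'X^2 + a1%:P * 'X + a0%:P.

Lemma horner_poly4 a4 a3 a2 a1 a0 y : (poly4 a4 a3 a2 a1 a0).[y] =
  a4 * y ^+ 4 + a3 * y ^+ 3 + a2 * y ^+ 2 + a1 * y + a0.
Proof. by rewrite /poly4 !hornerE. Qed.

Lemma horner_deriv_poly4 a4 a3 a2 a1 a0 y : (poly4 a4 a3 a2 a1 a0)^`().[y] =
  4 * a4 * y ^+ 3 + 3 * a3 * y ^+ 2 + 2 * a2 * y + a1.
Proof.
rewrite /poly4 !derivD !deriv_mulC !derivC !derivXn derivX /=.
rewrite !(hornerMn, hornerXn, hornerX, hornerC, hornerD, hornerM) hornerE.
by ring.
Qed.

Lemma quartFE a b c : quartF a b c = poly4 1 a 0 b c.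
Proof. by rewrite /quartF /poly4 !mul1r mul0r addr0. Qed.

Lemma separated3_scale j s y z : ~~ (3 %| y - z)%Z ->
  separated3 j (s + 3 ^+ j * y) (s + 3 ^+ j * z).
Proof.
apply: contra; have -> : s + 3 ^+ j * y - (s + 3 ^+ j * z) = 3 ^+ j * (y - z) by ring.
by rewrite exprSr dvdz_mul2l ?expf_neq0 //.
Qed.

(** The difference has valuation exactly [i]: the term 3^i x dominates because [x] is a unit at
    3. *)
Lemma separated3_lt i j s x z : (i < j)%N -> ~~ (3 %| x)%Z ->
  separated3 j (s + 3 ^+ i * x) (s + 3 ^+ j * z).
Proof.
move=> ltij; apply: contra => D.
have : (3 ^+ i.+1 %| s + 3 ^+ i * x - (s + 3 ^+ j * z))%Z.
  by apply: dvdz_trans D; rewrite -(subnKC (ltnW ltij : (i < j.+1)%N)) exprD dvdz_mulr.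
have -> : s + 3 ^+ i * x - (s + 3 ^+ j * z) = 3 ^+ i * (x - 3 * (3 ^+ (j - i.+1) * z)).
  rewrite -{1}(subnKC ltij) exprD exprSr; ring.
rewrite exprSr dvdz_mul2l ?expf_neq0 // => dx.
by rewrite -[x](subrK (3 * (3 ^+ (j - i.+1) * z))) rpredD // dvdz_mulr.
Qed.

Lemma dvd3_lift y z y0 z0 : (3 %| y - y0)%Z -> (3 %| z - z0)%Z ->
  ~~ (3 %| y0 - z0)%Z -> ~~ (3 %| y - z)%Z.
Proof.
move=> dy dz; apply: contra => d.
have -> : y0 - z0 = (y - z) - (y - y0) + (z - z0) by ring.
by apply: rpredD => //; apply: rpredB.
Qed.

Section Cases.

Variables (F : {poly int}) (s x0 : int).
Hypotheses (Fx0 : (3 %| F.[x0])%Z) (F'x0 : ~~ (3 %| F^`().[x0])%Z)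
  (x0s : ~~ (3 %| x0 - s)%Z).

(** One side carries three roots: the rescaled quartic is a_3 (y^3 - y) modulo 3, with simple roots
    0, 1, -1. The fourth root is the simple one lifted from [x0]. *)
Lemma local_roots_cubic j q a4 a3 a2 a1 a0 :
    (0 < j)%N -> (forall y, F.[s + 3 ^+ j * y] = q * (poly4 a4 a3 a2 a1 a0).[y]) ->
    (3 %| a4)%Z -> (3 %| a2)%Z -> (3 %| a0)%Z -> (3 %| a3 + a1)%Z -> ~~ (3 %| a1)%Z ->
  forall N, exists t : seq int, [/\ size t = 4, pairwise (separated3 j) t
       & forall x, x \in t -> (3 ^+ N %| F.[x])%Z].
Proof.
move=> j_gt0 FH /dvdzP[b4 E4] /dvdzP[b2 E2] /dvdzP[b0 E0] /dvdzP[b3 E3] n1 N.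
have root y0 : (3 %| y0 ^+ 3 - y0)%Z ->
    exists2 y, (3 %| y - y0)%Z & (3 ^+ N %| F.[s + 3 ^+ j * y])%Z.
  move=> /dvdzP[m Em]; apply: (scaled_hensel3 FH).
    rewrite horner_poly4; apply/dvdzP.
    exists (b4 * y0 ^+ 4 + a3 * m + b2 * y0 ^+ 2 + b3 * y0 + b0).
    have -> : a1 = b3 * 3 - a3 by rewrite -E3; ring.
    have -> : y0 ^+ 3 = m * 3 + y0 by rewrite -Em; ring.
    by rewrite E4 E2 E0; ring.
  rewrite horner_deriv_poly4; apply: contra n1 => /dvdzP[n En]; apply/dvdzP.
  exists (n - (4 * b4 * y0 ^+ 3 + a3 * y0 ^+ 2 + 2 * b2 * y0)).
  by rewrite mulrBl -En E4 E2; ring.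
have [y dy Fy] := root 0 isT; have [z dz Fz] := root 1 isT.
have [w dw Fw] := root (-1) isT; have [x dx Fx] := hensel3 Fx0 F'x0 N.
have xs : ~~ (3 %| x - s)%Z by apply: dvd3_lift dx _ x0s; rewrite subrr dvdz0.
exists [:: x; s + 3 ^+ j * y; s + 3 ^+ j * z; s + 3 ^+ j * w]; split=> //.
  have sepx t : separated3 j x (s + 3 ^+ j * t).
    have -> : x = s + 3 ^+ 0 * (x - s) by rewrite expr0; ring.
    exact: separated3_lt.
  rewrite /= !sepx !separated3_scale //.
  - exact: dvd3_lift dz dw _.
  - exact: dvd3_lift dy dw _.
  exact: dvd3_lift dy dz _.
by move=> t; rewrite !inE => /or4P[] /eqP ->.
Qed.

(** Besides the root lifted from [x0], one root lies at distance 3 from [s], and two lie at the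
    smaller distance 3^j or less, where the rescaled quartic becomes quadratic modulo 3. *)
Lemma local_roots_square j a4 a3 a2 a1 a0 y0 b4 b3 b2 b1 b0 q z1 z2 :
    (1 < j)%N -> (forall y, F.[s + 3 * y] = 27 * (poly4 a4 a3 a2 a1 a0).[y]) ->
    (forall y, F.[s + 3 ^+ j * y] = q * (poly4 b4 b3 b2 b1 b0).[y]) ->
    ~~ (3 %| y0)%Z -> (3 %| (poly4 a4 a3 a2 a1 a0).[y0])%Z ->
    ~~ (3 %| (poly4 a4 a3 a2 a1 a0)^`().[y0])%Z ->
    (3 %| b4)%Z -> (3 %| b3)%Z -> ~~ (3 %| z1 - z2)%Z ->
    (forall z, z \in [:: z1; z2] ->
       (3 %| b2 * z ^+ 2 + b1 * z + b0)%Z && ~~ (3 %| 2 * b2 * z + b1)%Z) ->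
  forall N, exists t : seq int, [/\ size t = 4, pairwise (separated3 j) t
       & forall x, x \in t -> (3 ^+ N %| F.[x])%Z].
Proof.
move=> j_gt1 FA FB ny0 Ay0 A'y0 /dvdzP[c4 E4] /dvdzP[c3 E3] nz12 Bz N.
have root z : z \in [:: z1; z2] ->
    exists2 y, (3 %| y - z)%Z & (3 ^+ N %| F.[s + 3 ^+ j * y])%Z.
  move=> /Bz/andP[/dvdzP[m Em] nB]; apply: (scaled_hensel3 FB).
    rewrite horner_poly4; apply/dvdzP; exists (c4 * z ^+ 4 + c3 * z ^+ 3 + m).
    by rewrite mulrDl -Em E4 E3; ring.
  rewrite horner_deriv_poly4; apply: contra nB => /dvdzP[n En]; apply/dvdzP.
  exists (n - (4 * c4 * z ^+ 3 + 3 * c3 * z ^+ 2)).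
  by rewrite mulrBl -En E4 E3; ring.
have [y dy Fy] := scaled_hensel3 FA Ay0 A'y0 N.
have [|z dz Fz] := root z1; first by rewrite inE eqxx.
have [|w dw Fw] := root z2; first by rewrite !inE eqxx orbT.
have [x dx Fx] := hensel3 Fx0 F'x0 N.
have xs : ~~ (3 %| x - s)%Z by apply: dvd3_lift dx _ x0s; rewrite subrr dvdz0.
have ny : ~~ (3 %| y)%Z.
  by have := @dvd3_lift y 0 y0 0 dy; rewrite !subr0; apply => //; apply: dvdz0.
exists [:: x; s + 3 * y; s + 3 ^+ j * z; s + 3 ^+ j * w]; split=> //.
  have xE : x = s + 3 ^+ 0 * (x - s) by rewrite expr0; ring.
  have sepx t : separated3 j x (s + 3 ^+ j * t).
    by rewrite xE; apply: separated3_lt xs; apply: ltnW.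
  have sepxy : separated3 j x (s + 3 * y).
    have : separated3 1 x (s + 3 ^+ 1 * y) by rewrite xE; apply: separated3_lt xs.
    rewrite expr1; apply: contra; apply: dvdz_trans.
    by rewrite -(subnKC (ltnW j_gt1 : (1 < j.+1)%N)) exprD dvdz_mulr.
  have sepy t : separated3 j (s + 3 * y) (s + 3 ^+ j * t).
    by have := separated3_lt s t j_gt1 ny; rewrite expr1.
  rewrite /= sepxy !sepx !sepy separated3_scale //.
  exact: dvd3_lift dz dw _.
by move=> t; rewrite !inE => /or4P[] /eqP ->.
Qed.

End Cases.

(** Modulo 3, [s] is a triple root and 0 a simple one. At scale 3 the expansion reduces to A y^3 + B
    y^2, giving the simple root [y0]. The other two roots are governed by 3 B d^2 + C d + M with B =
    -1 modulo 3, and the two alternatives say which of [C] and [M] dominates. *)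
Lemma local_roots_shifted_square a b c s A B C M y0 :
    (forall d, (poly4 1 a 0 b c).[s + d] = d ^+ 4 + A * d ^+ 3 + 3 * B * d ^+ 2 + C * d + M) ->
    (3 %| c)%Z -> ~~ (3 %| b)%Z -> ~~ (3 %| s)%Z ->
    ~~ (3 %| y0)%Z -> (3 %| A * y0 + B)%Z -> (3 %| B + 1)%Z ->
    (27 %| C)%Z -> (243 %| M)%Z ->
    (C != 0 /\ (M != 0 -> (2 * nu 3 C < nu 3 M + 1)%N)) \/
    [/\ (C == 0) || (M != 0) && (2 * nu 3 C > nu 3 M + 1)%N, M != 0, odd (nu 3 M)
      & (ppart 3 M == 1 %[mod 3])%Z] ->
  exists K, forall N, exists t : seq int, [/\ size t = 4, pairwise (separated3 K) t
    & forall x, x \in t -> (3 ^+ N %| (poly4 1 a 0 b c).[x])%Z].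
Proof.
move=> FE c3 b3 s3 ny0 /dvdzP[m0 Em0] /dvdzP[B' EB] C27 M243 cases.
have /dvdzP[C1 EC1] := C27; have /dvdzP[M1 EM1] := M243.
have F0 : (3 %| (poly4 1 a 0 b c).[0])%Z by rewrite horner_poly4 !expr0n !mulr0 !add0r.
have F'0 : ~~ (3 %| (poly4 1 a 0 b c)^`().[0])%Z.
  by rewrite horner_deriv_poly4 !expr0n !mulr0 !add0r.
have s0 : ~~ (3 %| 0 - s)%Z by rewrite sub0r rpredN.
have FA y : (poly4 1 a 0 b c).[s + 3 * y] = 27 * (poly4 3 A B (C1 * 3) (M1 * 9)).[y].
  by rewrite FE horner_poly4 EC1 EM1; ring.
have Ay0 : (3 %| (poly4 3 A B (C1 * 3) (M1 * 9)).[y0])%Z.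
  rewrite horner_poly4; apply/dvdzP; exists (y0 ^+ 4 + m0 * y0 ^+ 2 + C1 * y0 + M1 * 3).
  have -> : B = m0 * 3 - A * y0 by rewrite -Em0; ring.
  by ring.
have A'y0 : ~~ (3 %| (poly4 3 A B (C1 * 3) (M1 * 9))^`().[y0])%Z.
  apply: contra ny0; rewrite horner_deriv_poly4 => /dvdzP[m Em]; apply/dvdzP.
  exists (m - (4 * y0 ^+ 3 + A * y0 ^+ 2 + 2 * B' * y0 + C1) + y0).
  have EB2 : B = B' * 3 - 1 by rewrite -EB; ring.
  by rewrite mulrDl mulrBl -Em EB2; ring.
case: cases => [[nzC leM]|[leC nzM oddM /eqP M1mod]].
  (* Here [C] dominates: at scale 3^(nu(C) - 1), which is 9 T, the quadratic is -z^2 + n z modulo 3,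
     with the two simple roots 0 and [n]. *)
  have nuC : (2 < nu 3 C)%N by rewrite -dvd3X_nu.
  pose i := (nu 3 C - 3)%N; pose T : int := 3 ^+ i; pose n := ppart 3 C.
  have EC : C = 27 * T * n.
    by rewrite {1}(ppartE C) -/n -{1}(subnKC nuC) exprD.
  have n3 : ~~ (3 %| n)%Z.
    apply/negP => /dvdzP[m Em]; have : (3 ^+ (nu 3 C).+1 %| C)%Z.
      by apply/dvdzP; exists m; rewrite {1}(ppartE C) -/n Em exprS; ring.
    by rewrite dvd3X_nu // ltnn.
  have /dvdzP[m Em] : (729 * T ^+ 2 %| M)%Z.
    have -> : 729 * T ^+ 2 = 3 ^+ (2 * nu 3 C).
      by rewrite -(subnKC nuC) -/i mulnDr exprD [(2 * i)%N]mulnC [3 ^+ (i * 2)]exprM.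
    have [->|nzM] := eqVneq M 0; first exact: dvdz0.
    by rewrite dvd3X_nu //; have := leM nzM; lia.
  exists i.+2; apply: (@local_roots_square _ s 0 F0 F'0 s0 i.+2 3 A B (C1 * 3) (M1 * 9) y0
    (27 * T ^+ 2) (3 * A * T) B n (3 * m) (243 * T ^+ 2) 0 n) => //.
  - by move=> y; rewrite FE horner_poly4 EC Em !exprS -/T; ring.
  - by rewrite dvdz_mulr.
  - by rewrite -mulrA dvdz_mulr.
  - by rewrite sub0r rpredN.
  have EB2 : B = B' * 3 - 1 by rewrite -EB; ring.
  move=> z; rewrite !inE => /orP[] /eqP ->; apply/andP; split.
  - by rewrite expr0n !mulr0 !add0r dvdz_mulr.
  - by rewrite mulr0 add0r.
  - by apply/dvdzP; exists (B' * n ^+ 2 + m); rewrite EB2; ring.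
  apply: contra n3 => /dvdzP[k Ek]; apply/dvdzP; exists (2 * B' * n - k).
  by rewrite mulrBl -Ek EB2; ring.
(* Here [M] dominates: with nu(M) = 2 i + 5, the scale 9 T makes the quadratic -z^2 + m modulo 3. As
   [m] is 1 modulo 3, its roots are 1 and -1. *)
have nuM : (4 < nu 3 M)%N by rewrite -dvd3X_nu.
pose i := ((nu 3 M)./2 - 2)%N; pose T : int := 3 ^+ i; pose m := ppart 3 M.
have nuME : nu 3 M = (5 + i * 2)%N.
  by have := odd_double_half (nu 3 M); rewrite oddM /i -muln2; lia.
have EM : M = 243 * T ^+ 2 * m by rewrite {1}(ppartE M) -/m nuME exprD exprM.
have /dvdzP[k Ek] : (3 %| m - 1)%Z by rewrite -eqz_mod_dvd; apply/eqP.
have /dvdzP[n En] : (81 * T %| C)%Z.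
  have -> : 81 * T = 3 ^+ (4 + i) by rewrite exprD.
  have [->|nzC] := eqVneq C 0; first exact: dvdz0.
  by rewrite dvd3X_nu //; move: leC; rewrite (negPf nzC) nzM nuME /=; lia.
exists i.+2; apply: (@local_roots_square _ s 0 F0 F'0 s0 i.+2 3 A B (C1 * 3) (M1 * 9) y0
  (27 * T ^+ 2) (3 * A * T) B (3 * n) m (243 * T ^+ 2) 1 (-1)) => //.
- by move=> y; rewrite FE horner_poly4 EM En !exprS -/T; ring.
- by rewrite dvdz_mulr.
- by rewrite -mulrA dvdz_mulr.
have EB2 : B = B' * 3 - 1 by rewrite -EB; ring.
have Em : m = 1 + k * 3 by rewrite -Ek; ring.
move=> z; rewrite !inE => /orP[] /eqP ->; apply/andP; split.
- by apply/dvdzP; exists (B' + n + k); rewrite EB2 Em; ring.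
- by apply/negP => /dvdzP[l El];
  have : 2 = (2 * B' + n - l) * 3 by [rewrite mulrBl -El EB2; ring]; lia.
- by apply/dvdzP; exists (B' - n + k); rewrite EB2 Em; ring.
by apply/negP => /dvdzP[l El];
  have : 2 = (l + 2 * B' - n) * 3 by [rewrite mulrBl mulrDl -El EB2; ring]; lia.
Qed.

(** F is x^3 (x + a) modulo 3, with simple root -a. With nu(b) = 2 k, the substitution x = 3^k y and
    division by 3^(3k) leave a y^3 + b' y modulo 3, that is a (y^3 - y) since b' = -a; evenness of
    nu(b) makes the scale integral. *)
Lemma local_roots_case1 (a b c : int) :
    (a == 1 %[mod 3])%Z || (a == -1 %[mod 3])%Z ->
    (b == 0 %[mod 3])%Z && (c == 0 %[mod 3])%Z ->
    b != 0 /\ (c != 0 -> (3 * nu 3 b < 2 * nu 3 c)%N) ->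
    ~~ odd (nu 3 b) -> (ppart 3 b == - a %[mod 3])%Z ->
  exists K, forall N, exists t : seq int, [/\ size t = 4, pairwise (separated3 K) t
    & forall x, x \in t -> (3 ^+ N %| (poly4 1 a 0 b c).[x])%Z].
Proof.
move=> a3 /andP[b3 c3] [nzb le_c] even_b.
have [{}b3 {}c3] : (3 %| b)%Z /\ (3 %| c)%Z by move: b3 c3; rewrite !eqz_mod_dvd !subr0.
have na3 : ~~ (3 %| a)%Z by move: a3; lia.
rewrite eqz_mod_dvd opprK => ab3.
pose k := (nu 3 b)./2; have kE : nu 3 b = (k * 2)%N.
  by have := odd_double_half (nu 3 b); rewrite (negPf even_b) muln2 => <-.
have k_gt0 : (0 < k)%N.
  by have := dvd3X_nu 1 nzb; rewrite expr1 b3 kE; lia.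
pose T : int := 3 ^+ k; pose b' := ppart 3 b.
have Eb : b = T ^+ 2 * b' by rewrite {1}(ppartE b) -/b' kE exprM.
(* From 3 nu(b) < 2 nu(c) and nu(b) = 2 k follows nu(c) > 3 k, so the constant term vanishes modulo
   3 after rescaling. *)
have /dvdzP[c' Ec] : (T ^+ 3 * 3 %| c)%Z.
  have -> : T ^+ 3 * 3 = 3 ^+ (k * 3).+1 by rewrite [RHS]exprSr exprM.
  have [->|nzc] := eqVneq c 0; first exact: dvdz0.
  by rewrite dvd3X_nu //; have := le_c nzc; rewrite kE; lia.
exists k; apply: (@local_roots_cubic _ 0 (- a) _ _ _ k (T ^+ 3) T a 0 b' (c' * 3)) => //.
- have -> : (poly4 1 a 0 b c).[- a] = c - a * b by rewrite horner_poly4; ring.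
  by rewrite rpredB // dvdz_mull.
- have -> : (poly4 1 a 0 b c)^`().[- a] = b - a ^+ 3 by rewrite horner_deriv_poly4; ring.
  apply: contra na3 => d; have : (3 %| a ^+ 3)%Z.
    by rewrite -[a ^+ 3](subKr b) rpredB.
  by rewrite !dvdzE abszX Euclid_dvdX // => /andP[].
- by rewrite subr0 rpredN.
- by move=> y; rewrite !horner_poly4 -/T {1}Eb Ec; ring.
- by rewrite /T -(prednK k_gt0) exprS dvdz_mulr.
- exact: dvdz_mull.
- by rewrite addrC.
by apply: contra na3 => d; rewrite -[a](addKr b') rpredD ?rpredN.
Qed.

(** Modulo 3, F is (x - 1) (x + 1)^3. The congruences make F(-1 + 3 y) / 27 reduce to y^3 - y modulo
    3, so three roots lie on one side of slope 1. *)
Lemma local_roots_case4 (a b c : int) :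
    ((a %% 27)%Z, (b %% 27)%Z) \in
          [:: (2, 16); (5, 7); (8, 25); (11, 16); (14, 7); (17, 25);
              (20, 16); (23, 7); (26, 25)] ->
    (a + b == c + 1 %[mod 81])%Z ->
  exists K, forall N, exists t : seq int, [/\ size t = 4, pairwise (separated3 K) t
    & forall x, x \in t -> (3 ^+ N %| (poly4 1 a 0 b c).[x])%Z].
Proof.
rewrite !inE !xpair_eqE => ab abc.
have a3 : (a %% 3)%Z = 2 by move: ab; lia.
(* The value 18 is common to all listed pairs; divided by 9 it gives the coefficient 2, that is -1
   modulo 3, of y. *)
have C27 : ((-4 + 3 * a + b) %% 27)%Z = 18 by move: ab; lia.
pose C := ((-4 + 3 * a + b) %/ 9)%Z; pose M := ((1 - a - b + c) %/ 81)%Z.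
have EC : -4 + 3 * a + b = 9 * C by rewrite /C; lia.
have EM : 1 - a - b + c = 81 * M by rewrite /M; lia.
have C3 : (C %% 3)%Z = 2 by lia.
have Eb : b = 9 * C + 4 - 3 * a by lia.
have Ec : c = 81 * M - 1 + a + b by lia.
exists 1%N; apply: (@local_roots_cubic _ (-1) 1 _ _ _ 1 27 3 (a - 4) (2 - a) C (M * 3)) => //.
- by rewrite horner_poly4 !expr1n; lia.
- by rewrite horner_deriv_poly4 !expr1n; lia.
- by move=> y; rewrite !horner_poly4 Ec Eb; ring.
- by lia.
- exact: dvdz_mull.
- by lia.
by lia.
Qed.

Unset Implicit Arguments.
Set Strict Implicit.

Theorem theorem2p5 (a b c : int) (alpha : algC) :
  irreducible_poly (map_poly intr (quartF a b c) : {poly rat}) ->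
  root (map_poly intr (quartF a b c)) alpha ->
  let mu := nu 3 (1 - a - b + c) in
  let nv := nu 3 (-4 + 3 * a + b) in
  let om := nu 3 (1 + a + b + c) in
  let ta := nu 3 (4 + 3 * a + b) in
  [\/
    (* (1) *)
    [/\ (a == 1 %[mod 3])%Z || (a == -1 %[mod 3])%Z,
        (b == 0 %[mod 3])%Z && (c == 0 %[mod 3])%Z,
        b != 0 /\ (c != 0 -> (3 * nu 3 b < 2 * nu 3 c)%N),
        ~~ odd (nu 3 b)
      & (ppart 3 b == - a %[mod 3])%Z],
    (* (2) *)
    [/\ ((a %% 27)%Z, (b %% 27)%Z) \in
          [:: (0, 4); (3, 22); (6, 13); (9, 4); (12, 22); (15, 13);
              (18, 4); (21, 22); (24, 13)],
        (a + b == 1 + c %[mod 243])%Z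
      & (-4 + 3 * a + b != 0 /\ (1 - a - b + c != 0 -> (2 * nv < mu + 1)%N))
        \/ [/\ (-4 + 3 * a + b == 0) || (1 - a - b + c != 0) && (2 * nv > mu + 1)%N,
               1 - a - b + c != 0, odd mu
             & (ppart 3 (1 - a - b + c) == 1 %[mod 3])%Z]],
    (* (3) *)
    [/\ ((a %% 243)%Z, (b %% 243)%Z) \in
          [:: (0, 23); (3, 14); (6, 5); (9, 23); (12, 14); (15, 5);
              (18, 23); (21, 14); (24, 5)],
        (a + b == - (1 + c) %[mod 243])%Z
      & (4 + 3 * a + b != 0 /\ (1 + a + b + c != 0 -> (2 * ta < om + 1)%N))
        \/ [/\ (4 + 3 * a + b == 0) || (1 + a + b + c != 0) && (2 * ta > om + 1)%N,
               1 + a + b + c != 0, odd om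
             & (ppart 3 (1 + a + b + c) == 1 %[mod 3])%Z]]
  | (* (4) *)
    ((a %% 27)%Z, (b %% 27)%Z) \in
          [:: (2, 16); (5, 7); (8, 25); (11, 16); (14, 7); (17, 25);
              (20, 16); (23, 7); (26, 25)]
    /\ (a + b == c + 1 %[mod 81])%Z] ->
  exists g : nat,
    [/\ is_common_index alpha g, (3 %| g)%N, logn 3 g = 1%N & ~ monogenic alpha].
Proof.
move=> irrF rootF mu nv om ta cases.
have Fcoef : quartF a b c = Poly [:: c; b; 0; a; 1].
  by apply/polyP => -[|[|[|[|[|i]]]]]; rewrite coef_Poly /quartF !coefE /=
    ?mulr0 ?mulr1 ?addr0 ?add0r ?nth_nil.
have sF : size (quartF a b c) = 5 by rewrite Fcoef (@PolyK _ 1).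
have monF : quartF a b c \is monic by rewrite monicE lead_coefE sF Fcoef coef_Poly.
have DF : minCpoly alpha = pZ (quartF a b c).
  rewrite (minCpoly_irr (p := map_poly intr (quartF a b c))) ?pQ_intr //.
  by rewrite monic_map.
suffices [K local] : exists K, forall N, exists t : seq int,
    [/\ size t = 4, pairwise (separated3 K) t
      & forall x, x \in t -> (3 ^+ N %| (poly4 1 a 0 b c).[x])%Z].
  by apply: (local_roots_conclusion sF DF (K := K)) => N; rewrite quartFE.
case: cases => [[? ? ? ? ?]|[ab abc vals]|[ab abc vals]|[ab abc]].
- exact: local_roots_case1.
- move: ab; rewrite !inE !xpair_eqE => ab.
  (* The coefficients are those of the Taylor expansion at -1. Both a - 4 and 2 - a are -1 modulo 3,
     so the nearby root has y_0 = 2. *)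
  apply: (@local_roots_shifted_square a b c (-1) (a - 4) (2 - a)
    (-4 + 3 * a + b) (1 - a - b + c) 2) vals => //; try by move: ab; lia.
  by move=> d; rewrite horner_poly4; ring.
- move: ab; rewrite !inE !xpair_eqE => ab.
  (* Taylor expansion at 1: now a + 4 is 1 and 2 + a is -1 modulo 3, whence y_0 = 1. *)
  apply: (@local_roots_shifted_square a b c 1 (a + 4) (2 + a)
    (4 + 3 * a + b) (1 + a + b + c) 1) vals => //; try by move: ab; lia.
  by move=> d; rewrite horner_poly4; ring.
exact: local_roots_case4.
Qed.
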